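(* Let $z\in\mathbb{C}\setminus\{0\}$, $\theta=\arg(-z)$, and let $\delta$ be an arbitrary small positive number. Then for each integer $n\ge0$ $$\mathrm{Hi}(z)=-\frac{1}{\pi z}\sum_{k=0}^n\frac{(3k)!}{k!(3z^3)^k}+\frac1\pi\varepsilon_{2n+4}^{(-1,1)}(z),$$ where $$\left|\varepsilon_{2n+4}^{(-1,1)}(z)\right|\le\frac{(3n+3)!}{3^{n+1}(n+1)!\,|z|^{3n+4}}\qquad\left(|\theta|\le\tfrac16\pi\right),$$ and $$\left|\varepsilon_{2n+4}^{(-1,1)}(z)\right|\le\frac{(3n+3)!}{3^{n+1}(n+1)!\left\{|z|\cos\left(|\theta|-\tfrac16\pi\right)\right\}^{3n+4}}\qquad\left(\tfrac16\pi<|\theta|\le\tfrac23\pi-\delta\right).$$ Likewise $$\mathrm{Hi}'(z)=\frac{1}{\pi z^2}\sum_{k=0}^n\frac{(3k+1)!}{k!(3z^3)^k}+\frac1\pi\tilde\varepsilon_{2n+5}^{(-1,1)}(z),$$ where $$\left|\tilde\varepsilon_{2n+5}^{(-1,1)}(z)\right|\le\frac{(3n+4)!}{3^{n+1}(n+1)!\,|z|^{3n+5}}\qquad\left(|\theta|\le\tfrac16\pi\right),$$ and $$\left|\tilde\varepsilon_{2n+5}^{(-1,1)}(z)\right|\le\frac{(3n+4)!}{3^{n+1}(n+1)!\left\{|z|\cos\left(|\theta|-\tfrac16\pi\right)\right\}^{3n+5}}\qquad\left(\tfrac16\pi<|\theta|\le\tfrac23\pi-\delta\right).$$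
   Context: The Scorer function is $\mathrm{Hi}(z)=\dfrac1\pi\displaystyle\int_0^\infty\exp\left(-\tfrac13t^3+zt\right)dt$ for $z\in\mathbb{C}$. The argument $\arg(-z)$ takes its principal value. The displayed expansions define the error terms $\varepsilon_{2n+4}^{(-1,1)}$ and $\tilde\varepsilon_{2n+5}^{(-1,1)}$. *)

(* Defs.v *)
From Stdlib Require Import Reals Factorial Lra.
From Coquelicot Require Import Coquelicot.
Open Scope R_scope.

Definition Cexp (z : C) : C :=
  (exp (Re z) * cos (Im z), exp (Re z) * sin (Im z)).

                                                                  
Definition Carg (z : C) : R :=
  if Rle_dec 0 (Im z) then acos (Re z / Cmod z) else - acos (Re z / Cmod z).

Lemma Carg_spec (z : C) :
  z <> 0%C ->
  - PI < Carg z <= PI /\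
  z = (Cmod z * cos (Carg z), Cmod z * sin (Carg z)).
Proof.
intros Hz.
assert (Hm : 0 < Cmod z) by now apply Cmod_gt_0.
assert (Hsq := Cmod2_alt z).
set (m := Cmod z) in *.
assert (Hb : -1 <= Re z / m <= 1).
{ assert (Ha : Rabs (Re z) <= m) by apply re_le_Cmod.
  assert (Hr : -m <= Re z <= m) by (split; unfold Rabs in Ha; destruct (Rcase_abs (Re z)); lra).
  assert (E : Re z = (Re z / m) * m) by (field; lra).
  split; apply Rmult_le_reg_r with m; lra. }
assert (Hs : sqrt (1 - (Re z / m)²) = Rabs (Im z) / m).
{ replace (1 - (Re z / m)²) with ((Rabs (Im z) / m)²).
  - apply sqrt_Rsqr, Rmult_le_pos; [apply Rabs_pos | left; now apply Rinv_0_lt_compat].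
  - rewrite !Rsqr_div', <- Rsqr_abs. unfold Rsqr.
    apply Rmult_eq_reg_r with (m * m); [|nra]. field_simplify; nra. }
assert (B := acos_bound (Re z / m)).
assert (Ec := cos_acos _ Hb).
assert (Es := sin_acos _ Hb). rewrite Hs in Es.
unfold Carg; fold m; destruct (Rle_dec 0 (Im z)) as [Hi|Hi].
- rewrite Ec, Es, Rabs_pos_eq by exact Hi.
  split; [assert (P := PI_RGT_0); lra|].
  destruct z as [x y]; simpl in *; f_equal; field; lra.
- rewrite cos_neg, sin_neg, Ec, Es, Rabs_left by lra.
  split.
  + assert (acos (Re z / m) <> PI).
    { intros E. rewrite E, sin_PI in Es. rewrite Rabs_left in Es by lra.
      assert (0 < - Im z / m) by (apply Rdiv_lt_0_compat; lra). lra. }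
    assert (P := PI_RGT_0); lra.
  + destruct z as [x y]; simpl in *; f_equal; field; lra.
Qed.

                                                               
Definition Hi (z : C) : C :=
  (/ PI *
   RInt_gen (V := C_R_CompleteNormedModule)
     (fun t : R => Cexp (- (1 / 3) * t ^ 3 + z * t))
     (at_point 0) (Rbar_locally p_infty))%C.

                             
Definition Hi' (z : C) : C := C_derive Hi z.

                                                                  
Definition Hi_sum (n : nat) (z : C) : C :=
  sum_n (fun k => INR (fact (3 * k)) / (INR (fact k) * (3 * z ^ 3) ^ k))%C n.

Definition Hi'_sum (n : nat) (z : C) : C :=
  sum_n (fun k => INR (fact (3 * k + 1)) / (INR (fact k) * (3 * z ^ 3) ^ k))%C n.

                                                                             
                                                                               
Definition Hi_err (n : nat) (z : C) : C :=
  (PI * (Hi z - - (1 / (PI * z)) * Hi_sum n z))%C.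

Definition Hi'_err (n : nat) (z : C) : C :=
  (PI * (Hi' z - 1 / (PI * z ^ 2) * Hi'_sum n z))%C.

(* Main.v *)
Require Import Defs.
From Stdlib Require Import Reals Factorial Lra Lia.
From Coquelicot Require Import Coquelicot.
Open Scope R_scope.

(** Write [- z = rho * exp (i theta)]. Along a ray [t = s * exp (i phi)] with
    [Rabs phi <= PI / 6] the cube [t ^ 3] has nonnegative real part, so the Taylor
    remainder of [exp (- t ^ 3 / 3)] after the term of index [n] is at most the modulus of
    the next term ([Cexp_taylor], [ray_remainder_bound]), while [exp (z * t)] has modulus
    [exp (- rho * s * cos (theta + phi))]. Integrating the Taylor terms gives the terms of
    the expansion ([exp_moment_lim]), integrating the bound on the remainder gives
    [(3n+3+j)! / (3^(n+1) (n+1)! (rho cos (theta + phi))^(3n+4+j))], where [j = 0] for [Hi]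
    and [j = 1] for its derivative ([Hi_moment_error]). The two bounds come from
    the ray [phi = - theta] when [Rabs theta <= PI / 6], and from [phi = - PI / 6] or
    [phi = PI / 6] otherwise.

    Two facts justify this computation. First, the path of integration may be turned from
    the positive axis to the ray of argument [phi] whenever [cos (theta + phi) > 0]. For the
    integral truncated at distance [X], the derivative with respect to the angle is a
    boundary term at distance [X] ([is_derive_RInt_ray_wave]), and this term is
    exponentially small uniformly in the intermediate angles ([ray_log_mod_le]), so the
    integrals along both rays have the same limit ([Hi_moment_rotate]). Second, [Hi] is
    complex differentiable and its derivative is obtained under the integral sign
    ([is_derive_Hi_moment]). All estimates are made on truncated integrals, and only the
    final inequality passes to the limit. *)

(** * Calculus of complex-valued functions of a real variable *)

(** For a complex-valued function of a real variable, differentiability, continuity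
    and integrability can all be checked on the real and imaginary parts, where the
    real automation applies. *)
Lemma is_derive_C (f : R -> C) (x : R) (l : C) :
  is_derive (V := R_NormedModule) (fun t => Re (f t)) x (Re l) ->
  is_derive (V := R_NormedModule) (fun t => Im (f t)) x (Im l) ->
  is_derive (V := C_R_NormedModule) f x l.
Proof.
intros Hr Hi.
assert (H : is_derive (V := C_R_NormedModule) (fun t => (Re (f t), Im (f t))) x l).
{ unfold is_derive in *.
  apply (filterdiff_ext_lin (U := R_NormedModule) (V := C_R_NormedModule) _
           (fun y : R => (scal (V := R_NormedModule) y (Re l),
                          scal (V := R_NormedModule) y (Im l)))).
  - apply (filterdiff_comp'_2 (U := R_NormedModule) (V := R_NormedModule)
             (W := C_R_NormedModule)
             (fun t => Re (f t)) (fun t => Im (f t)) (fun a b => (a, b))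
             x _ _ (fun a b => (a, b)) Hr Hi).
    apply (filterdiff_ext (U := C_R_NormedModule) (V := C_R_NormedModule) (fun t => t)); [now intros []|].
    apply (filterdiff_ext_lin (U := C_R_NormedModule) (V := C_R_NormedModule) _ (fun t => t)); [|now intros []].
    apply filterdiff_linear, is_linear_id.
  - intros y. now destruct l. }
apply (is_derive_ext (V := C_R_NormedModule) _ _ _ _
         (fun t => eq_sym (surjective_pairing (f t))) H).
Qed.

Notation Ccontinuous := (continuous (T := R_UniformSpace) (U := C_UniformSpace)).

Lemma continuous_C (f : R -> C) (x : R) :
  continuous (fun t => Re (f t)) x ->
  continuous (fun t => Im (f t)) x ->
  Ccontinuous f x.
Proof.
intros Hr Hi.
apply (continuous_ext (T := R_UniformSpace) (U := C_UniformSpace) (fun t => (Re (f t), Im (f t))));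
  [intros t; now destruct (f t)|].
apply (continuous_comp_2 (X := C_UniformSpace) _ _ (fun a b => (a, b)) x Hr Hi).
apply (continuous_ext (T := C_UniformSpace) (U := C_UniformSpace) (fun t => t)); [now intros []|].
apply continuous_id.
Qed.

Lemma continuous_Re_comp (f : R -> C) (x : R) :
  Ccontinuous f x ->
  continuous (fun t => Re (f t)) x.
Proof.
intros H. apply (continuous_comp (V := C_UniformSpace) f (fun u : C => fst u)); [exact H|].
apply (continuous_fst (U := R_UniformSpace) (V := R_UniformSpace)).
Qed.

Lemma continuous_Im_comp (f : R -> C) (x : R) :
  Ccontinuous f x ->
  continuous (fun t => Im (f t)) x.
Proof.
intros H. apply (continuous_comp (V := C_UniformSpace) f (fun u : C => snd u)); [exact H|].
apply (continuous_snd (U := R_UniformSpace) (V := R_UniformSpace)).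
Qed.

Lemma continuous_RtoC_comp (f : R -> R) (x : R) :
  continuous f x -> Ccontinuous (fun t => RtoC (f t)) x.
Proof. intros H. apply continuous_C; [exact H | apply continuous_const]. Qed.

Lemma continuous_Cplus (f g : R -> C) (x : R) :
  Ccontinuous f x -> Ccontinuous g x ->
  Ccontinuous (fun t => f t + g t)%C x.
Proof. exact (continuous_plus (V := C_R_NormedModule) f g x). Qed.

Lemma continuous_Cminus (f g : R -> C) (x : R) :
  Ccontinuous f x -> Ccontinuous g x ->
  Ccontinuous (fun t => f t - g t)%C x.
Proof. exact (continuous_minus (V := C_R_NormedModule) f g x). Qed.

Lemma continuous_Copp (f : R -> C) (x : R) :
  Ccontinuous f x -> Ccontinuous (fun t => - f t)%C x.
Proof. exact (continuous_opp (V := C_R_NormedModule) f x). Qed.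

Lemma continuous_Cmult (f g : R -> C) (x : R) :
  Ccontinuous f x -> Ccontinuous g x ->
  Ccontinuous (fun t => f t * g t)%C x.
Proof.
intros Hf Hg.
assert (H1 := continuous_Re_comp _ _ Hf). assert (H2 := continuous_Im_comp _ _ Hf).
assert (H3 := continuous_Re_comp _ _ Hg). assert (H4 := continuous_Im_comp _ _ Hg).
apply continuous_C; simpl.
- apply (continuous_minus (V := R_NormedModule)); apply (continuous_mult (K := R_AbsRing)); assumption.
- apply (continuous_plus (V := R_NormedModule)); apply (continuous_mult (K := R_AbsRing)); assumption.
Qed.

Lemma continuous_Cpow (f : R -> C) (n : nat) (x : R) :
  Ccontinuous f x ->
  Ccontinuous (fun t => f t ^ n)%C x.
Proof.
intros Hf; induction n as [|n IH]; simpl.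
- apply continuous_const.
- now apply continuous_Cmult.
Qed.

Lemma continuous_Cexp (f : R -> C) (x : R) :
  Ccontinuous f x ->
  Ccontinuous (fun t => Cexp (f t)) x.
Proof.
intros Hf.
assert (H1 := continuous_Re_comp _ _ Hf). assert (H2 := continuous_Im_comp _ _ Hf).
apply continuous_C; simpl; apply (continuous_mult (K := R_AbsRing)).
- apply (continuous_exp_comp (fun t => Re (f t)) x H1).
- apply (continuous_cos_comp (fun t => Im (f t)) x H2).
- apply (continuous_exp_comp (fun t => Re (f t)) x H1).
- apply (continuous_sin_comp (fun t => Im (f t)) x H2).
Qed.

Lemma continuous_Csum (f : nat -> R -> C) (n : nat) (x : R) :
  (forall k, Ccontinuous (f k) x) ->
  Ccontinuous (fun t => sum_n (G := C_AbelianMonoid) (fun k => f k t) n) x.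
Proof.
intros Hf. induction n as [|n IH].
- apply (continuous_ext (T := R_UniformSpace) (U := C_UniformSpace) (f 0%nat)); [|apply Hf].
  intros t. now rewrite sum_O.
- apply (continuous_ext (T := R_UniformSpace) (U := C_UniformSpace)
           (fun t => sum_n (G := C_AbelianMonoid) (fun k => f k t) n + f (S n) t)%C).
  { intros t. symmetry. apply (sum_Sn (G := C_AbelianMonoid) (fun k => f k t) n). }
  now apply continuous_Cplus.
Qed.

(** Continuity is dispatched on the head symbol: applying the closure lemmas blindly
    would let unification unfold complex operations into pairs and diverge. *)
Ltac C_cont :=
  match goal with
  | |- continuous (fun _ => Cplus _ _) _ => apply continuous_Cplus; C_cont
  | |- continuous (fun _ => Cminus _ _) _ => apply continuous_Cminus; C_cont
  | |- continuous (fun _ => Copp _) _ => apply continuous_Copp; C_cont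
  | |- continuous (fun _ => Cmult _ _) _ => apply continuous_Cmult; C_cont
  | |- continuous (fun _ => Cexp _) _ => apply continuous_Cexp; C_cont
  | |- continuous (fun _ => Cpow _ _) _ => apply continuous_Cpow; C_cont
  | |- continuous (fun _ => sum_n _ _) _ => apply continuous_Csum; intros ?; C_cont
  | |- continuous (fun _ => ?c) _ => apply continuous_const
  | |- continuous (fun _ => RtoC _) _ => apply continuous_RtoC_comp; C_cont
  | |- continuous RtoC _ => apply (continuous_RtoC_comp (fun t => t)); C_cont
  | |- continuous (fun x => x) _ => apply continuous_id
  | |- continuous (fun _ => pow _ _) _ =>
      apply (ex_derive_continuous (V := R_NormedModule)); auto_derive; auto
  end.

(** * The complex exponential and its Taylor remainder *)

Lemma Cexp_plus (u v : C) : Cexp (u + v) = (Cexp u * Cexp v)%C.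
Proof.
unfold Cexp; destruct u as [a b], v as [c d]; simpl.
rewrite exp_plus, cos_plus, sin_plus. apply injective_projections; simpl; ring.
Qed.

Lemma Cmod_Cexp (u : C) : Cmod (Cexp u) = exp (Re u).
Proof.
unfold Cexp, Cmod; simpl.
replace (_ + _) with (exp (Re u) ^ 2 * ((sin (Im u))² + (cos (Im u))²)) by (unfold Rsqr; ring).
rewrite sin2_cos2, Rmult_1_r. apply sqrt_pow2. left; apply exp_pos.
Qed.

Lemma Cexp_0 : Cexp 0 = RtoC 1.
Proof. unfold Cexp; simpl. rewrite exp_0, cos_0, sin_0. apply injective_projections; simpl; ring. Qed.

Lemma is_derive_Cexp_line (v : C) (x : R) :
  is_derive (V := C_R_NormedModule) (fun t : R => Cexp (t * v)) x (v * Cexp (x * v))%C.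
Proof. apply is_derive_C; destruct v as [a b]; simpl; auto_derive; auto; unfold Rminus; ring. Qed.

(** Generic lemmas leave equations typed in a structure whose carrier is only
    convertible to [C]; [ring] and [field] need the carrier itself. *)
Ltac to_C := match goal with |- @eq _ ?a ?b => change (@eq C a b) end.

Definition exp_poly (n : nat) (v : C) : C :=
  sum_n (G := C_AbelianMonoid) (fun k => / INR (fact k) * v ^ k)%C n.

Lemma is_derive_exp_poly_line (n : nat) (v : C) (x : R) :
  is_derive (V := C_R_NormedModule) (fun t : R => exp_poly (S n) (t * v)) x (v * exp_poly n (x * v))%C.
Proof.
induction n as [|n IH].
- unfold exp_poly.
  apply (is_derive_ext (V := C_R_NormedModule) (fun t : R => 1 + t * v)%C).
  { intros t. rewrite sum_Sn, sum_O. simpl. change plus with Cplus.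
    apply injective_projections; simpl; field. }
  rewrite sum_O. apply is_derive_C; destruct v as [a b]; simpl; auto_derive; auto; field.
- apply (is_derive_ext (V := C_R_NormedModule) (fun t : R => exp_poly (S n) (t * v) + / INR (fact (S (S n))) * (t * v) ^ (S (S n)))%C).
  { intros t. unfold exp_poly. now rewrite (sum_Sn _ (S n)). }
  replace (v * exp_poly (S n) (x * v))%C
    with (plus (G := C_R_NormedModule) (v * exp_poly n (x * v))%C (v * (/ INR (fact (S n)) * (x * v) ^ S n))%C).
  2:{ unfold exp_poly at 2. rewrite sum_Sn. change plus with Cplus. unfold exp_poly. to_C. ring. }
  apply (is_derive_plus (V := C_R_NormedModule)); [exact IH|].
  apply (is_derive_ext (V := C_R_NormedModule)
    (fun t : R => scal (V := C_R_NormedModule) (t ^ S (S n)) (/ INR (fact (S (S n))) * v ^ S (S n))%C)).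
  { intros t. rewrite Cpow_mult_l, scal_R_Cmult, RtoC_pow. to_C. ring. }
  replace (v * (/ INR (fact (S n)) * (x * v) ^ S n))%C
    with (scal (V := C_R_NormedModule) (INR (S (S n)) * x ^ S n) (/ INR (fact (S (S n))) * v ^ S (S n))%C).
  + apply (is_derive_scal_l (K := R_AbsRing) (V := C_R_NormedModule) (fun t : R => t ^ S (S n))).
    auto_derive; auto. rewrite Rmult_1_l. reflexivity.
  + rewrite Cpow_mult_l, scal_R_Cmult, RtoC_mult, <- RtoC_pow. rewrite (fact_simpl (S n)), mult_INR, RtoC_mult.
    rewrite (Cpow_S v (S n)). to_C. field.
    split; intros E; apply RtoC_inj in E; [apply (INR_fact_neq_0 _ E)|].
    apply (not_0_INR (S (S n))); [lia|exact E].
Qed.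

Notation CInt := (RInt (V := C_R_CompleteNormedModule)).

Lemma ex_CInt (f : R -> C) (a b : R) :
  (forall t, Ccontinuous f t) -> ex_RInt (V := C_R_NormedModule) f a b.
Proof.
intros Hf. apply (ex_RInt_continuous (V := C_R_CompleteNormedModule)). intros t _; apply Hf.
Qed.

Lemma CInt_correct (f : R -> C) (a b : R) :
  (forall t, Ccontinuous f t) -> is_RInt (V := C_R_NormedModule) f a b (CInt f a b).
Proof. intros Hf. apply (RInt_correct (V := C_R_CompleteNormedModule)), ex_CInt, Hf. Qed.

Lemma norm_C_R (z : C) : norm (K := R_AbsRing) (V := C_R_NormedModule) z = Cmod z.
Proof.
unfold Cmod. change (sqrt (Rabs (fst z) ^ 2 + Rabs (snd z) ^ 2) = sqrt (fst z ^ 2 + snd z ^ 2)).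
now rewrite !pow2_abs.
Qed.

Lemma is_CInt_norm_le (f : R -> C) (g : R -> R) (a b : R) (lf : C) (lg : R) :
  a <= b -> (forall x, a <= x <= b -> Cmod (f x) <= g x) ->
  is_RInt (V := C_R_NormedModule) f a b lf -> is_RInt (V := R_NormedModule) g a b lg ->
  Cmod lf <= lg.
Proof.
intros Hab Hfg Hf Hg. rewrite <- norm_C_R.
refine (norm_RInt_le (V := C_R_NormedModule) f g a b lf lg Hab _ Hf Hg).
intros x Hx. rewrite norm_C_R. now apply Hfg.
Qed.

(** Mean value inequality by integration of the derivative. Integrating a bound
    [K * x ^ m] rather than its supremum is what produces the factorial in the Taylor
    remainder below. *)
Lemma C_derive_power_growth (F dF : R -> C) (K : R) (m : nat) :
  (forall x, is_derive (V := C_R_NormedModule) F x (dF x)) ->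
  (forall x, Ccontinuous dF x) ->
  (forall x, 0 <= x <= 1 -> Cmod (dF x) <= K * x ^ m) ->
  Cmod (F 1 - F 0) <= K / INR (S m).
Proof.
intros HF Hc Hb.
refine (is_CInt_norm_le dF (fun x => K * x ^ m) 0 1 _ _ Rle_0_1 Hb _ _).
- apply (is_RInt_derive (V := C_R_CompleteNormedModule) F); intros x _; [apply HF | apply Hc].
- assert (Hm : INR (S m) <> 0) by (apply not_0_INR; lia).
  replace (K / INR (S m)) with
    (minus (K / INR (S m) * 1 ^ S m) (K / INR (S m) * 0 ^ S m))
    by (unfold minus, plus, opp; cbn -[INR]; rewrite pow1; field; exact Hm).
  apply (is_RInt_derive (V := R_CompleteNormedModule) (fun x => K / INR (S m) * x ^ S m)).
  + intros x _. auto_derive; auto. change (pred (S m)) with m. field. exact Hm.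
  + intros x _. apply (ex_derive_continuous (V := R_NormedModule) (fun x => K * x ^ m)). auto_derive; auto.
Qed.

(** The remainder of order [n + 1], restricted to the segment from [0] to [v], has
    derivative [v] times the remainder of order [n], so the bound follows by induction
    on [n]. The factor [Rmax 1 (exp (Re v))] dominates [Cexp] on the whole segment; it
    equals [1] when [Re v <= 0], which makes the final error bounds free of any
    additional constant. *)
Lemma Cexp_taylor (n : nat) (v : C) :
  Cmod (Cexp v - exp_poly n v)
    <= Rmax 1 (exp (Re v)) * Cmod v ^ S n / INR (fact (S n)).
Proof.
assert (Hmax : forall (w : C) (x : R), 0 <= x <= 1 -> Rmax 1 (exp (Re (x * w)%C)) <= Rmax 1 (exp (Re w))).
{ intros w x Hx. assert (M1 := Rmax_l 1 (exp (Re w))). assert (M2 := Rmax_r 1 (exp (Re w))).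
  apply Rmax_lub; [exact M1|].
  replace (Re (x * w)%C) with (x * Re w) by (destruct w; simpl; ring).
  destruct (Rle_dec 0 (Re w)) as [Hw|Hw].
  - eapply Rle_trans; [|exact M2].
    destruct (Req_dec (x * Re w) (Re w)) as [->|Hne]; [lra|].
    left; apply exp_increasing; nra.
  - eapply Rle_trans; [|exact M1]. rewrite <- exp_0.
    destruct (Req_dec (x * Re w) 0) as [->|Hne]; [lra|]. left; apply exp_increasing; nra. }
revert v; induction n as [|n IH]; intros v.
- replace (Cexp v - exp_poly 0 v)%C with ((Cexp (1 * v) - 1) - (Cexp (0 * v) - 1))%C.
  2:{ unfold exp_poly. rewrite sum_O, Cmult_1_l, Cmult_0_l, Cexp_0. simpl.
      replace (/ 1 * 1)%C with (RtoC 1) by field. ring. }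
  refine (Rle_trans _ _ _ (C_derive_power_growth (fun t : R => Cexp (t * v) - 1)%C
     (fun t : R => v * Cexp (t * v))%C (Cmod v * Rmax 1 (exp (Re v))) 0 _ _ _) _).
  + intros x. replace (v * Cexp (x * v))%C with (minus (G := C_R_NormedModule) (v * Cexp (x * v))%C zero)
      by (apply (minus_zero_r (G := C_R_NormedModule))).
    apply (is_derive_minus (V := C_R_NormedModule)); [apply is_derive_Cexp_line|].
    apply (is_derive_const (V := C_R_NormedModule)).
  + intros x. C_cont.
  + intros x Hx. rewrite Cmod_mult, Cmod_Cexp, pow_O, Rmult_1_r.
    apply Rmult_le_compat_l; [apply Cmod_ge_0|].
    eapply Rle_trans; [apply (Rmax_r 1)|]. now apply Hmax.
  + right. simpl. field.
- replace (Cexp v - exp_poly (S n) v)%C with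
    ((Cexp (1 * v) - exp_poly (S n) (1 * v)) - (Cexp (0 * v) - exp_poly (S n) (0 * v)))%C.
  2:{ rewrite Cmult_1_l, Cmult_0_l, Cexp_0.
      replace (exp_poly (S n) 0) with (RtoC 1); [ring|].
      clear. unfold exp_poly. induction (S n) as [|m IHm].
      - rewrite sum_O. simpl. field.
      - rewrite sum_Sn, <- IHm. change plus with Cplus. simpl. ring. }
  refine (Rle_trans _ _ _ (C_derive_power_growth (fun t : R => Cexp (t * v) - exp_poly (S n) (t * v))%C
     (fun t : R => v * (Cexp (t * v) - exp_poly n (t * v)))%C
     (Rmax 1 (exp (Re v)) * Cmod v ^ S (S n) / INR (fact (S n))) (S n) _ _ _) _).
  + intros x. replace (v * (Cexp (x * v) - exp_poly n (x * v)))%C with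
      (minus (G := C_R_NormedModule) (v * Cexp (x * v))%C (v * exp_poly n (x * v))%C)
      by (change (v * Cexp (x * v) - v * exp_poly n (x * v) = v * (Cexp (x * v) - exp_poly n (x * v)))%C; ring).
    apply (is_derive_minus (V := C_R_NormedModule)); [apply is_derive_Cexp_line|].
    apply is_derive_exp_poly_line.
  + intros x. unfold exp_poly. C_cont.
  + intros x Hx. rewrite Cmod_mult.
    eapply Rle_trans; [apply Rmult_le_compat_l; [apply Cmod_ge_0 | apply IH]|].
    rewrite Cmod_mult, Cmod_R, Rabs_pos_eq, Rpow_mult_distr by lra.
    assert (H1 := Hmax v x Hx).
    assert (0 < / INR (fact (S n))) by (apply Rinv_0_lt_compat, INR_fact_lt_0).
    assert (0 <= Cmod v ^ S (S n) * x ^ S n * / INR (fact (S n))).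
    { apply Rmult_le_pos; [apply Rmult_le_pos; apply pow_le; [apply Cmod_ge_0|lra]|lra]. }
    unfold Rdiv.
    apply (Rmult_le_compat_r _ _ _ H0) in H1.
    eapply Rle_trans; [|eapply Rle_trans; [exact H1|]]; right; simpl; ring.
  + right. rewrite (fact_simpl (S n)), mult_INR. field.
    split; [apply INR_fact_neq_0|apply not_0_INR; lia].
Qed.

(** * Limits at infinity *)

Notation at_infinity F l :=
  (filterlim F (Rbar_locally p_infty) (locally (T := C_UniformSpace) l)).

Lemma at_infinity_squeeze (F : R -> C) (g : R -> R) (l : C) :
  Rbar_locally p_infty (fun X => Cmod (F X - l) <= g X) ->
  is_lim g p_infty 0 -> at_infinity F l.
Proof.
intros HF Hg. apply (filterlim_locally (U := C_UniformSpace)). intros eps.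
assert (Hg' := proj1 (filterlim_locally (U := R_UniformSpace) g 0) Hg eps).
generalize (filter_and _ _ HF Hg'). apply filter_imp. intros X [H1 H2].
apply (norm_compat1 (K := C_AbsRing) (V := C_NormedModule)).
change (Cmod (F X - l) < eps).
eapply Rle_lt_trans; [exact H1|].
change (Rabs (g X - 0) < eps) in H2. rewrite Rminus_0_r in H2.
eapply Rle_lt_trans; [apply Rle_abs|exact H2].
Qed.

Lemma at_infinity_plus (F G : R -> C) (l m : C) :
  at_infinity F l -> at_infinity G m -> at_infinity (fun X => F X + G X)%C (l + m)%C.
Proof.
intros HF HG. exact (filterlim_comp_2 _ _ _ HF HG (filterlim_plus (V := C_NormedModule) l m)).
Qed.

Lemma at_infinity_scal (F : R -> C) (c l : C) :
  at_infinity F l -> at_infinity (fun X => c * F X)%C (c * l)%C.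
Proof.
intros HF. exact (filterlim_comp _ _ _ _ _ _ _ _ HF (filterlim_scal_r (V := C_NormedModule) c l)).
Qed.

Lemma at_infinity_minus (F G : R -> C) (l m : C) :
  at_infinity F l -> at_infinity G m -> at_infinity (fun X => F X - G X)%C (l - m)%C.
Proof.
intros HF HG.
apply (filterlim_ext (fun X => F X + -1 * G X)%C); [intros X; ring|].
replace (l - m)%C with (l + -1 * m)%C by ring.
now apply at_infinity_plus, at_infinity_scal.
Qed.

Lemma at_infinity_sum (F : nat -> R -> C) (l : nat -> C) (n : nat) :
  (forall k, at_infinity (F k) (l k)) ->
  at_infinity (fun X => sum_n (G := C_AbelianMonoid) (fun k => F k X) n) (sum_n (G := C_AbelianMonoid) l n).
Proof.
intros H; induction n as [|n IH].
- rewrite sum_O. apply (filterlim_ext (F 0%nat)); [intros X; now rewrite sum_O | apply H].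
- rewrite sum_Sn.
  apply (filterlim_ext (fun X => sum_n (G := C_AbelianMonoid) (fun k => F k X) n + F (S n) X)%C).
  { intros X. now rewrite sum_Sn. }
  now apply at_infinity_plus.
Qed.

Lemma at_infinity_Cmod_le (F : R -> C) (l : C) (B : R) :
  at_infinity F l -> Rbar_locally p_infty (fun X => Cmod (F X) <= B) -> Cmod l <= B.
Proof.
intros HF HB.
assert (HN : is_lim (fun X => Cmod (F X)) p_infty (Cmod l)).
{ exact (filterlim_comp _ _ _ _ _ _ _ _ HF (filterlim_norm (V := C_NormedModule) l)). }
exact (filterlim_le (fun X => Cmod (F X)) (fun _ => B) (Cmod l) B HB HN (filterlim_const _)).
Qed.

(** * Laplace integrals of powers *)

(** A single term of the exponential series is at most its sum. *)
Lemma pow_le_fact_exp (m : nat) (x : R) : 0 <= x -> x ^ m <= INR (fact m) * exp x.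
Proof.
intros Hx. assert (H := exp_ge_taylor x m Hx).
assert (Hf := INR_fact_lt_0 m).
assert (Ht : x ^ m / INR (fact m) <= exp x).
{ eapply Rle_trans; [|exact H]. destruct m as [|m]; [simpl; lra|].
  rewrite tech5.
  assert (0 <= sum_f_R0 (fun k => x ^ k / INR (fact k)) m); [|lra].
  apply cond_pos_sum. intros k. apply Rmult_le_pos; [now apply pow_le|].
  left; apply Rinv_0_lt_compat, INR_fact_lt_0. }
apply (Rmult_le_compat_l (INR (fact m))) in Ht; [|lra].
eapply Rle_trans; [|exact Ht]. right. field. lra.
Qed.

Lemma is_lim_pow_exp (m : nat) (a : R) :
  0 < a -> is_lim (fun X => X ^ m * exp (- (a * X))) p_infty 0.
Proof.
intros Ha.
set (K := INR (fact (S m)) / a ^ S m).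
apply (is_lim_le_le_loc (fun _ => 0) (fun X => K * / X)).
- exists 0. intros X HX. split.
  + apply Rmult_le_pos; [apply pow_le; lra | left; apply exp_pos].
  + assert (H := pow_le_fact_exp (S m) (a * X) ltac:(nra)).
    assert (Hp : 0 < a ^ S m) by now apply pow_lt.
    rewrite Rpow_mult_distr in H.
    rewrite exp_Ropp.
    assert (He := exp_pos (a * X)).
    apply (Rmult_le_reg_r (X * exp (a * X) * a ^ S m)); [now repeat (assumption || apply Rmult_lt_0_compat)|].
    replace (X ^ m * / exp (a * X) * (X * exp (a * X) * a ^ S m)) with (a ^ S m * X ^ S m)
      by (simpl; field; lra).
    eapply Rle_trans; [exact H|]. right. unfold K. field. lra.
- apply is_lim_const.
- replace (Finite 0) with (Rbar_mult K (Rbar_inv p_infty)) by (simpl; f_equal; ring).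
  apply is_lim_scal_l. apply is_lim_inv; [apply is_lim_id | discriminate].
Qed.

(** The upper bound is the value of the full integral up to infinity; integration by
    parts lowers [m], and the boundary term at [X] has the favourable sign. *)
Lemma RInt_pow_exp_le (m : nat) (a X : R) :
  0 < a -> 0 <= X ->
  RInt (fun s => s ^ m * exp (- (a * s))) 0 X <= INR (fact m) / a ^ S m.
Proof.
intros Ha HX.
assert (Hex : forall k, ex_RInt (V := R_NormedModule) (fun s => s ^ k * exp (- (a * s))) 0 X).
{ intros k. apply (ex_RInt_continuous (V := R_CompleteNormedModule)). intros s _.
  apply (ex_derive_continuous (V := R_NormedModule) (fun s => s ^ k * exp (- (a * s)))). auto_derive; auto. }
assert (HC : forall k s, continuous (fun s : R => s ^ k * exp (- (a * s))) s).
{ intros k s. apply (ex_derive_continuous (V := R_NormedModule) (fun s => s ^ k * exp (- (a * s)))). auto_derive; auto. }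
induction m as [|m IH].
- assert (H : is_RInt (V := R_NormedModule) (fun s => s ^ 0 * exp (- (a * s))) 0 X
     (minus (- / a * exp (- (a * X))) (- / a * exp (- (a * 0))))).
  { apply (is_RInt_derive (V := R_CompleteNormedModule) (fun s => - / a * exp (- (a * s)))).
    - intros s _. auto_derive; auto. field. lra.
    - intros s _. apply HC. }
  rewrite (is_RInt_unique (V := R_CompleteNormedModule) _ _ _ _ H).
  unfold minus, plus, opp; simpl. rewrite Rmult_0_r, Ropp_0, exp_0.
  assert (0 < / a * exp (- (a * X))) by (apply Rmult_lt_0_compat; [now apply Rinv_0_lt_compat|apply exp_pos]).
  unfold Rdiv. rewrite !Rmult_1_r. lra.
- assert (H : is_RInt (V := R_NormedModule)
     (fun s => INR (S m) * (s ^ m * exp (- (a * s))) - a * (s ^ S m * exp (- (a * s)))) 0 X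
     (minus (X ^ S m * exp (- (a * X))) (0 ^ S m * exp (- (a * 0))))).
  { apply (is_RInt_derive (V := R_CompleteNormedModule) (fun s => s ^ S m * exp (- (a * s)))).
    - intros s _. auto_derive; auto. change (match m with 0%nat => 1 | S _ => INR m + 1 end) with (INR (S m)); rewrite <- ?tech_pow_Rmult. ring.
    - intros s _. apply (continuous_minus (V := R_NormedModule));
      apply (continuous_scal_r (V := R_NormedModule)); apply HC. }
  assert (H' : is_RInt (V := R_NormedModule)
     (fun s => INR (S m) * (s ^ m * exp (- (a * s))) - a * (s ^ S m * exp (- (a * s)))) 0 X
     (INR (S m) * RInt (fun s => s ^ m * exp (- (a * s))) 0 X - a * RInt (fun s => s ^ S m * exp (- (a * s))) 0 X)).
  { apply (is_RInt_minus (V := R_NormedModule)); apply (is_RInt_scal (V := R_NormedModule));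
    apply (RInt_correct (V := R_CompleteNormedModule)), Hex. }
  assert (E := eq_trans (eq_sym (is_RInt_unique (V := R_CompleteNormedModule) _ _ _ _ H))
      (is_RInt_unique (V := R_CompleteNormedModule) _ _ _ _ H')).
  change (X ^ S m * exp (- (a * X)) - 0 ^ S m * exp (- (a * 0))
    = INR (S m) * RInt (fun s => s ^ m * exp (- (a * s))) 0 X
      - a * RInt (fun s => s ^ S m * exp (- (a * s))) 0 X) in E.
  rewrite (pow_ne_zero (S m)), Rmult_0_l in E by lia.
  assert (0 <= X ^ S m * exp (- (a * X))) by (apply Rmult_le_pos; [now apply pow_le|left; apply exp_pos]).
  assert (Hm := pos_INR (S m)).
  apply (Rmult_le_compat_l (INR (S m))) in IH; [|exact Hm].
  apply (Rmult_le_reg_l a); [exact Ha|].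
  eapply Rle_trans; [|eapply Rle_trans; [exact IH|]].
  + lra.
  + right. rewrite fact_simpl, mult_INR. simpl (a ^ S (S m)). simpl (a ^ S m). field.
    split; [apply pow_nonzero|]; lra.
Qed.

Lemma is_CInt_Cmult (c : C) (f : R -> C) (a b : R) (l : C) :
  is_RInt (V := C_R_NormedModule) f a b l ->
  is_RInt (V := C_R_NormedModule) (fun t => c * f t)%C a b (c * l)%C.
Proof.
intros H.
assert (H1 := is_RInt_fct_extend_fst (U := R_NormedModule) (V := R_NormedModule) _ _ _ _ H).
assert (H2 := is_RInt_fct_extend_snd (U := R_NormedModule) (V := R_NormedModule) _ _ _ _ H).
apply (is_RInt_fct_extend_pair (U := R_NormedModule) (V := R_NormedModule)).
- apply (is_RInt_minus (V := R_NormedModule)); now apply (is_RInt_scal (V := R_NormedModule)).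
- apply (is_RInt_plus (V := R_NormedModule)); now apply (is_RInt_scal (V := R_NormedModule)).
Qed.

Lemma CInt_unique (f : R -> C) (a b : R) (l : C) :
  is_RInt (V := C_R_NormedModule) f a b l -> CInt f a b = l.
Proof. exact (is_RInt_unique (V := C_R_CompleteNormedModule) f a b l). Qed.

Definition exp_moment (m : nat) (b : C) (X : R) : C := CInt (fun s : R => s ^ m * Cexp (- (b * s)))%C 0 X.

Lemma exp_moment_0 (b : C) (X : R) :
  (b * exp_moment 0 b X = 1 - Cexp (- (b * X)))%C.
Proof.
assert (H : is_RInt (V := C_R_NormedModule)
   (fun s : R => b * (s ^ 0 * Cexp (- (b * s))))%C 0 X
   (minus (G := C_R_NormedModule) (- Cexp (- (b * X)))%C (- Cexp (- (b * 0%R)))%C)).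
{ apply (is_RInt_derive (V := C_R_CompleteNormedModule) (fun s : R => - Cexp (- (b * s)))%C).
  - intros s _.
    destruct b as [x y]; apply is_derive_C; cbn; auto_derive; auto;
    cbn; unfold Rminus; ring.
  - intros s _. C_cont. }
assert (H' := is_CInt_Cmult b _ _ _ _ (CInt_correct (fun s : R => s ^ 0 * Cexp (- (b * s)))%C 0 X ltac:(intros; C_cont))).
unfold exp_moment. rewrite <- (CInt_unique _ _ _ _ H'), (CInt_unique _ _ _ _ H).
change (- Cexp (- (b * X)) - - Cexp (- (b * 0%R)) = 1 - Cexp (- (b * X)))%C.
rewrite Cmult_0_r, Copp_0, Cexp_0. ring.
Qed.

Lemma exp_moment_S (m : nat) (b : C) (X : R) :
  (b * exp_moment (S m) b X = INR (S m) * exp_moment m b X - X ^ S m * Cexp (- (b * X)))%C.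
Proof.
assert (H : is_RInt (V := C_R_NormedModule)
   (fun s : R => INR (S m) * (s ^ m * Cexp (- (b * s))) - b * (s ^ S m * Cexp (- (b * s))))%C 0 X
   (minus (G := C_R_NormedModule) (X ^ S m * Cexp (- (b * X)))%C (0%R ^ S m * Cexp (- (b * 0%R)))%C)).
{ apply (is_RInt_derive (V := C_R_CompleteNormedModule) (fun s : R => s ^ S m * Cexp (- (b * s)))%C).
  - intros s _.
    apply (is_derive_ext (V := C_R_NormedModule) (fun s : R => RtoC (s ^ S m) * Cexp (- (b * s)))%C).
    { intros t. now rewrite RtoC_pow. }
    rewrite <- !RtoC_pow.
    destruct b as [x y]; apply is_derive_C; cbn -[pow INR]; auto_derive; auto;
    cbn -[pow INR];
    change (match m with 0%nat => 1 | S _ => INR m + 1 end) with (INR (S m)); rewrite <- ?tech_pow_Rmult;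
    unfold Rminus; ring.
  - intros s _. C_cont. }
assert (HI : forall k, is_RInt (V := C_R_NormedModule)
   (fun s : R => s ^ k * Cexp (- (b * s)))%C 0 X (exp_moment k b X)).
{ intros k. apply CInt_correct. intros; C_cont. }
assert (H' := is_RInt_minus (V := C_R_NormedModule) _ _ _ _ _ _
  (is_CInt_Cmult (INR (S m)) _ _ _ _ (HI m)) (is_CInt_Cmult b _ _ _ _ (HI (S m)))).
assert (E := eq_trans (eq_sym (CInt_unique _ _ _ _ H)) (CInt_unique _ _ _ _ H')).
change ((X ^ S m * Cexp (- (b * X)) - 0%R ^ S m * Cexp (- (b * 0%R)))
  = INR (S m) * exp_moment m b X - b * exp_moment (S m) b X)%C in E.
rewrite (Cpow_S 0), !Cmult_0_l in E.
replace (X ^ S m * Cexp (- (b * X)))%C with (INR (S m) * exp_moment m b X - b * exp_moment (S m) b X)%C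
  by (rewrite <- E; ring).
ring.
Qed.

Lemma at_infinity_pow_exp (m : nat) (b : C) :
  0 < Re b -> at_infinity (fun X : R => X ^ m * Cexp (- (b * X)))%C (RtoC 0).
Proof.
intros Hb. apply (at_infinity_squeeze _ (fun X => X ^ m * exp (- (Re b * X)))).
- exists 0. intros X HX. unfold Cminus. rewrite Copp_0, Cplus_0_r.
  rewrite Cmod_mult, Cmod_Cexp, Cmod_pow, Cmod_R, Rabs_pos_eq by lra.
  right. f_equal. f_equal. destruct b; simpl; ring.
- now apply is_lim_pow_exp.
Qed.

(** The recursion given by integration by parts passes to the limit: the boundary
    terms vanish because [Re b > 0]. *)
Lemma exp_moment_lim (m : nat) (b : C) :
  0 < Re b -> at_infinity (exp_moment m b) (INR (fact m) / b ^ S m)%C.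
Proof.
intros Hb.
assert (Hb0 : b <> 0%C) by (intros ->; simpl in Hb; lra).
induction m as [|m IH].
- apply (filterlim_ext (fun X : R => / b * (1 - X ^ 0 * Cexp (- (b * X))))%C).
  { intros X. replace (X ^ 0 * Cexp (- (b * X)))%C with (Cexp (- (b * X))) by (simpl; ring).
    rewrite <- exp_moment_0. now field. }
  replace (INR (fact 0) / b ^ 1)%C with (/ b * (1 - 0))%C by (simpl; now field).
  apply at_infinity_scal, at_infinity_minus; [apply filterlim_const|now apply at_infinity_pow_exp].
- apply (filterlim_ext (fun X : R => / b * (INR (S m) * exp_moment m b X - X ^ S m * Cexp (- (b * X))))%C).
  { intros X. rewrite <- exp_moment_S. now field. }
  replace (INR (fact (S m)) / b ^ S (S m))%C with (/ b * (INR (S m) * (INR (fact m) / b ^ S m) - 0))%C.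
  2:{ rewrite fact_simpl, mult_INR, RtoC_mult, !Cpow_S. field. split; [now apply Cpow_nz|exact Hb0]. }
  apply at_infinity_scal, at_infinity_minus; [now apply at_infinity_scal|now apply at_infinity_pow_exp].
Qed.

(** * The moments of the Scorer integrand *)

Definition Hi_integrand (j : nat) (z : C) (t : R) : C :=
  (t ^ j * Cexp (- (1 / 3) * t ^ 3 + z * t))%C.

(** Up to the factor [/ PI], these are [Hi] for [j = 0] and its derivative for
    [j = 1]. Treating all [j] at once lets one error estimate serve both expansions. *)
Definition Hi_moment (j : nat) (z : C) : C :=
  RInt_gen (V := C_R_CompleteNormedModule) (Hi_integrand j z) (at_point 0) (Rbar_locally p_infty).

Lemma continuous_Hi_integrand (j : nat) (z : C) (t : R) : Ccontinuous (Hi_integrand j z) t.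
Proof. unfold Hi_integrand. C_cont. Qed.

Lemma Cmod_Hi_integrand (j : nat) (z : C) (t : R) :
  0 <= t -> Cmod (Hi_integrand j z t) = t ^ j * exp (Re z * t - t ^ 3 / 3).
Proof.
intros Ht. unfold Hi_integrand.
rewrite Cmod_mult, Cmod_Cexp, Cmod_pow, Cmod_R, Rabs_pos_eq by exact Ht.
f_equal. f_equal. destruct z as [x y]. rewrite <- RtoC_pow. simpl. field.
Qed.

(** The cubic decay leaves [exp (- t)] as an integrable dominating function, whatever the
    power of [t] and the exponential growth of the other factors. *)
Lemma Hi_integrand_bound (j : nat) (c : R) :
  exists K, 0 < K /\ forall t : R, 0 <= t ->
    t ^ j * exp (c * t - t ^ 3 / 3) <= K * exp (- t).
Proof.
set (d := Rabs c + 2).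
assert (Hd : 2 <= d) by (unfold d; generalize (Rabs_pos c); lra).
(* [t ^ j <= j! * exp t] costs one unit of the rate and the target [exp (- t)] a second one,
   hence [d = Rabs c + 2]; beyond [3 * d + 1] the cubic beats [d * t]. *)
exists (INR (fact j) * exp (d * (3 * d + 1))). split.
{ apply Rmult_lt_0_compat; [apply INR_fact_lt_0 | apply exp_pos]. }
intros t Ht.
assert (Hcd : c + 2 <= d) by (unfold d; generalize (Rle_abs c); lra).
assert (H1 := pow_le_fact_exp j t Ht).
assert (H2 : c * t - t ^ 3 / 3 + t <= d * (3 * d + 1) + - t).
{ assert (d * t - t ^ 3 / 3 <= d * (3 * d + 1)); [|nra].
  destruct (Rle_dec t (3 * d + 1)) as [Hl|Hl].
  - assert (0 <= t ^ 3) by now apply pow_le. nra.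
  - assert (3 * d <= t ^ 2) by nra.
    assert (0 <= t * (t ^ 2 - 3 * d)) by (apply Rmult_le_pos; lra).
    nra. }
assert (H3 : exp (c * t - t ^ 3 / 3 + t) <= exp (d * (3 * d + 1) + - t)).
{ destruct H2 as [H2|H2]; [left; now apply exp_increasing | rewrite H2; lra]. }
rewrite !exp_plus in H3.
assert (He := exp_pos (c * t - t ^ 3 / 3)).
assert (Hf := INR_fact_lt_0 j).
eapply Rle_trans; [apply Rmult_le_compat_r; [lra|exact H1]|].
rewrite !Rmult_assoc. apply Rmult_le_compat_l; lra.
Qed.

Lemma C_minus_of_plus (u v w : C) : (u + v = w)%C -> (w - u = v)%C.
Proof. intros <-. ring. Qed.

Lemma Hi_moment_spec (j : nat) (z : C) :
  is_RInt_gen (V := C_R_NormedModule) (Hi_integrand j z)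
    (at_point 0) (Rbar_locally p_infty) (Hi_moment j z) /\
  at_infinity (fun X => CInt (Hi_integrand j z) 0 X) (Hi_moment j z).
Proof.
destruct (Hi_integrand_bound j (Re z)) as [K [HK Hb]].
assert (Hc := continuous_Hi_integrand j z).
assert (Htail : forall X Y, 0 <= X -> X <= Y ->
  Cmod (CInt (Hi_integrand j z) 0 Y - CInt (Hi_integrand j z) 0 X) <= K * exp (- X)).
{ intros X Y HX HXY.
  replace (CInt (Hi_integrand j z) 0 Y - CInt (Hi_integrand j z) 0 X)%C with (CInt (Hi_integrand j z) X Y).
  2:{ symmetry. apply C_minus_of_plus.
      now apply (RInt_Chasles (V := C_R_CompleteNormedModule)); apply ex_CInt. }
  eapply Rle_trans.
  - refine (is_CInt_norm_le _ (fun t => K * exp (- t)) X Y _ (minus (- K * exp (- Y)) (- K * exp (- X))) HXY _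
             (CInt_correct _ X Y Hc) _).
    + intros t Ht. rewrite Cmod_Hi_integrand by lra. apply Hb; lra.
    + apply (is_RInt_derive (V := R_CompleteNormedModule) (fun t => - K * exp (- t))).
      * intros t _. auto_derive; auto. ring.
      * intros t _. apply (ex_derive_continuous (V := R_NormedModule) (fun t => K * exp (- t))). auto_derive; auto.
  - change (- K * exp (- Y) - (- K * exp (- X)) <= K * exp (- X)).
    generalize (exp_pos (- Y)). nra. }
assert (Hex : exists l : C, at_infinity (fun X => CInt (Hi_integrand j z) 0 X) l).
{ apply (filterlim_locally_cauchy (U := CompleteNormedModule.CompleteSpace _ C_R_CompleteNormedModule)).
  intros eps.
  assert (Hl := is_lim_scal_l _ K _ _ (is_lim_pow_exp 0 1 Rlt_0_1)).
  simpl in Hl. rewrite Rmult_0_r in Hl.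
  assert (He := proj1 (filterlim_locally (U := R_UniformSpace) _ 0) Hl eps).
  destruct He as [X0 HX0].
  set (X := Rmax 0 X0 + 1).
  assert (HX : 0 <= X) by (unfold X; generalize (Rmax_l 0 X0); lra).
  assert (Hlt : forall Y, X <= Y -> K * exp (- Y) < eps).
  { intros Y HY. assert (H := HX0 Y ltac:(unfold X in HY; generalize (Rmax_r 0 X0); lra)).
    change (Rabs (K * (1 * exp (- (1 * Y))) - 0) < eps) in H.
    rewrite Rminus_0_r, !Rmult_1_l in H. eapply Rle_lt_trans; [apply Rle_abs|exact H]. }
  exists (fun Y => X < Y). split; [now exists X|].
  assert (Hw : forall u v, X < u -> u <= v -> 
     Cmod (CInt (Hi_integrand j z) 0 v - CInt (Hi_integrand j z) 0 u) < eps).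
  { intros u v Hu Huv. eapply Rle_lt_trans; [apply Htail; lra|apply Hlt; lra]. }
  intros u v Hu Hv.
  apply (norm_compat1 (K := C_AbsRing) (V := C_NormedModule)).
  change (Cmod (CInt (Hi_integrand j z) 0 v - CInt (Hi_integrand j z) 0 u) < eps).
  destruct (Rle_dec u v) as [Huv|Huv]; [now apply Hw|].
  rewrite <- Cmod_opp, Copp_minus_distr. apply Hw; lra. }
destruct Hex as [l Hl].
assert (Hg : is_RInt_gen (V := C_R_NormedModule) (Hi_integrand j z)
               (at_point 0) (Rbar_locally p_infty) l).
{ intros P HP.
  apply Filter_prod with (Q := fun a => a = 0) (R := fun X => P (CInt (Hi_integrand j z) 0 X));
    [reflexivity | exact (Hl P HP) |].
  intros a X -> HX. exists (CInt (Hi_integrand j z) 0 X). split; [|exact HX].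
  now apply CInt_correct. }
replace (Hi_moment j z) with l; [now split|].
symmetry.
exact (is_RInt_gen_unique (V := C_R_CompleteNormedModule)
         (Fa := at_point 0) (Fb := Rbar_locally p_infty) (Hi_integrand j z) l Hg).
Qed.

Lemma Hi_moment_0 (z : C) : Hi z = (/ PI * Hi_moment 0 z)%C.
Proof.
assert (E : forall t : R, Hi_integrand 0 z t = Cexp (- (1 / 3) * t ^ 3 + z * t)).
{ intros t. unfold Hi_integrand. simpl (RtoC t ^ 0)%C. apply Cmult_1_l. }
assert (Hex : ex_RInt_gen (V := C_R_NormedModule) (Hi_integrand 0 z)
                (at_point 0) (Rbar_locally p_infty)).
{ exists (Hi_moment 0 z). apply Hi_moment_spec. }
unfold Hi, Hi_moment.
rewrite (RInt_gen_ext_eq (V := C_R_CompleteNormedModule)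
           (Fa := at_point 0) (Fb := Rbar_locally p_infty) _ _ E Hex).
reflexivity.
Qed.

(** * The derivative of the Scorer function *)

Lemma is_C_derive_quadratic (f : C -> C) (z l : C) (K : R) :
  (forall h : C, Cmod h <= 1 -> Cmod (f (z + h)%C - f z - h * l) <= K * Cmod h ^ 2) ->
  is_derive (K := C_AbsRing) (V := C_NormedModule) f z l.
Proof.
intros H. split; [apply (is_linear_scal_l (V := C_NormedModule))|].
intros x Hx.
apply (is_filter_lim_locally_unique (K := C_AbsRing) (V := AbsRing_NormedModule C_AbsRing)) in Hx.
subst x. intros eps.
set (d := Rmin 1 (eps / (Rabs K + 1))).
assert (HK := Rabs_pos K).
assert (Hd : 0 < d).
{ apply Rmin_pos; [lra|]. apply Rdiv_lt_0_compat; [apply cond_pos|lra]. }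
exists (mkposreal d Hd).
change (forall y : C, Cmod (y - z) < d ->
          Cmod (f y - f z - (y - z) * l) <= eps * Cmod (y - z)).
intros y Hy.
assert (H1 : Cmod (y - z) <= 1) by (generalize (Rmin_l 1 (eps / (Rabs K + 1))); unfold d in Hy; lra).
assert (H2 : Cmod (y - z) <= eps / (Rabs K + 1)) by (generalize (Rmin_r 1 (eps / (Rabs K + 1))); unfold d in Hy; lra).
specialize (H _ H1). replace (z + (y - z))%C with y in H by ring.
eapply Rle_trans; [exact H|].
replace (K * Cmod (y - z) ^ 2) with ((K * Cmod (y - z)) * Cmod (y - z)) by ring.
apply Rmult_le_compat_r; [apply Cmod_ge_0|].
apply (Rmult_le_compat_r (Rabs K + 1)) in H2; [|lra].
replace (eps / (Rabs K + 1) * (Rabs K + 1)) with (pos eps) in H2 by (field; lra).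
generalize (Rle_abs K) (Cmod_ge_0 (y - z)). nra.
Qed.

Lemma Hi_integrand_increment (j : nat) (z h : C) (t : R) :
  (Hi_integrand j (z + h) t - Hi_integrand j z t - h * Hi_integrand (S j) z t
   = Hi_integrand j z t * (Cexp (t * h) - exp_poly 1 (t * h)))%C.
Proof.
unfold Hi_integrand, exp_poly. rewrite sum_Sn, sum_O.
replace (- (1 / 3) * t ^ 3 + (z + h) * t)%C with ((- (1 / 3) * t ^ 3 + z * t) + t * h)%C by ring.
rewrite Cexp_plus. change plus with Cplus. simpl.
replace (/ 1)%C with (RtoC 1) by field. to_C. ring.
Qed.

(** Differentiation under the integral sign without any limit theorem: the second
    order Taylor remainder of [Cexp (t * h)] is bounded by [Cmod h ^ 2] times an
    integrable function of [t], so the difference quotient converges with a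
    quadratic error. *)
Lemma is_derive_Hi_moment (j : nat) (z : C) :
  is_derive (K := C_AbsRing) (V := C_NormedModule) (Hi_moment j) z (Hi_moment (S j) z).
Proof.
destruct (Hi_integrand_bound (S (S j)) (Re z + 1)) as [K [HK Hb]].
apply is_C_derive_quadratic with K. intros h Hh.
apply (at_infinity_Cmod_le
  (fun X => CInt (Hi_integrand j (z + h)) 0 X - CInt (Hi_integrand j z) 0 X
            - h * CInt (Hi_integrand (S j) z) 0 X)%C).
{ apply at_infinity_minus; [apply at_infinity_minus|apply at_infinity_scal];
  apply Hi_moment_spec. }
exists 0. intros X HX.
assert (HI : forall k w, is_RInt (V := C_R_NormedModule) (Hi_integrand k w) 0 X (CInt (Hi_integrand k w) 0 X))
  by (intros k w; apply CInt_correct, continuous_Hi_integrand).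
assert (H := is_RInt_minus (V := C_R_NormedModule) _ _ _ _ _ _
  (is_RInt_minus (V := C_R_NormedModule) _ _ _ _ _ _ (HI j (z + h)%C) (HI j z))
  (is_CInt_Cmult h _ _ _ _ (HI (S j) z))).
eapply Rle_trans; [refine (is_CInt_norm_le _ (fun t => K * Cmod h ^ 2 * exp (- t)) 0 X _ 
   (minus (- (K * Cmod h ^ 2) * exp (- X)) (- (K * Cmod h ^ 2) * exp (- 0))) _ _ H _)|].
- lra.
- intros t Ht.
  change (Cmod (Hi_integrand j (z + h) t - Hi_integrand j z t - h * Hi_integrand (S j) z t)
     <= K * Cmod h ^ 2 * exp (- t)).
  rewrite Hi_integrand_increment, Cmod_mult, Cmod_Hi_integrand by lra.
  assert (HT := Cexp_taylor 1 (t * h)).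
  assert (Hm : Rmax 1 (exp (Re (t * h)%C)) <= exp t).
  { apply Rmax_lub.
    - generalize (exp_ineq1_le t). lra.
    - replace (Re (t * h)%C) with (t * Re h) by (destruct h; simpl; ring).
      assert (Hr : Re h <= 1).
      { eapply Rle_trans; [apply Rle_abs|]. eapply Rle_trans; [apply re_le_Cmod|exact Hh]. }
      assert (Hle : t * Re h <= t) by nra.
      destruct Hle as [Hle|Hle]; [left; now apply exp_increasing|rewrite Hle; lra]. }
  rewrite Cmod_mult, Cmod_R, Rabs_pos_eq in HT by lra.
  assert (Hh2 := pow2_ge_0 (Cmod h)).
  assert (Hq : Rmax 1 (exp (Re (t * h)%C)) * (t * Cmod h) ^ 2 / INR (fact 2) <= exp t * (t ^ 2 * Cmod h ^ 2)).
  { rewrite Rpow_mult_distr. assert (Ht2 := pow2_ge_0 t).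
    assert (P : 0 <= t ^ 2 * Cmod h ^ 2) by now apply Rmult_le_pos.
    assert (Hone := Rmax_l 1 (exp (Re (t * h)%C))). 
    replace (INR (fact 2)) with 2 by (simpl; ring).
    assert (Q := Rmult_le_compat_r _ _ _ P Hm). nra. }
  specialize (Hb t (proj1 Ht)).
  replace ((Re z + 1) * t - t ^ 3 / 3) with ((Re z * t - t ^ 3 / 3) + t) in Hb by ring.
  rewrite exp_plus in Hb.
  assert (Hp : 0 <= t ^ j * exp (Re z * t - t ^ 3 / 3)).
  { apply Rmult_le_pos; [now apply pow_le|left; apply exp_pos]. }
  eapply Rle_trans; [apply Rmult_le_compat_l; [exact Hp|eapply Rle_trans; [exact HT|exact Hq]]|].
  apply (Rmult_le_compat_r _ _ _ Hh2) in Hb.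
  eapply Rle_trans; [|eapply Rle_trans; [exact Hb|]]; right; simpl; ring.
- apply (is_RInt_derive (V := R_CompleteNormedModule) (fun t => - (K * Cmod h ^ 2) * exp (- t))).
  + intros t _. auto_derive; auto. ring.
  + intros t _. apply (ex_derive_continuous (V := R_NormedModule) (fun t => K * Cmod h ^ 2 * exp (- t))). auto_derive; auto.
- change (- (K * Cmod h ^ 2) * exp (- X) - (- (K * Cmod h ^ 2) * exp (- 0)) <= K * Cmod h ^ 2).
  rewrite Ropp_0, exp_0. assert (0 <= K * Cmod h ^ 2 * exp (- X)); [|lra].
  apply Rmult_le_pos; [|left; apply exp_pos]. apply Rmult_le_pos; [lra|apply pow2_ge_0].
Qed.

Lemma is_derive_Hi (z : C) :
  is_derive (K := C_AbsRing) (V := C_NormedModule) Hi z (/ PI * Hi_moment 1 z)%C.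
Proof.
apply (is_derive_ext (K := C_AbsRing) (V := C_NormedModule) (fun w => scal (/ PI)%C (Hi_moment 0 w))).
{ intros w. symmetry. apply Hi_moment_0. }
apply (filterdiff_ext_lin (K := C_AbsRing) (U := AbsRing_NormedModule C_AbsRing) (V := C_NormedModule)
         _ (fun y : C => / PI * (y * Hi_moment 1 z))%C).
- exact (filterdiff_scal_r_fct (K := C_AbsRing) (U := AbsRing_NormedModule C_AbsRing)
           (V := C_NormedModule) (/ PI)%C (Hi_moment 0) (fun y : C => y * Hi_moment 1 z)%C
           Cmult_comm (is_derive_Hi_moment 0 z)).
- intros y. change (/ PI * (y * Hi_moment 1 z) = y * (/ PI * Hi_moment 1 z))%C.
  now rewrite !Cmult_assoc, (Cmult_comm y).
Qed.

Lemma Hi'_moment_1 (z : C) : Hi' z = (/ PI * Hi_moment 1 z)%C.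
Proof. apply is_C_derive_unique, is_derive_Hi. Qed.

(** * Rotation of the path of integration *)

Definition cis (phi : R) : C := (cos phi, sin phi).

Lemma cis_0 : cis 0 = RtoC 1.
Proof. unfold cis. now rewrite cos_0, sin_0. Qed.

Lemma cis_plus (a b : R) : cis (a + b) = (cis a * cis b)%C.
Proof. unfold cis. rewrite cos_plus, sin_plus. apply injective_projections; simpl; ring. Qed.

Lemma cis_pow (k : nat) (a : R) : (cis a ^ k)%C = cis (INR k * a).
Proof.
induction k as [|k IH].
- rewrite Rmult_0_l, cis_0. reflexivity.
- rewrite Cpow_S, IH, <- cis_plus, S_INR. f_equal. ring.
Qed.

Lemma Cmod_cis (a : R) : Cmod (cis a) = 1.
Proof.
unfold Cmod, cis; simpl. rewrite !Rmult_1_r.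
replace (_ + _) with (Rsqr (sin a) + Rsqr (cos a)) by (unfold Rsqr; ring).
rewrite sin2_cos2. apply sqrt_1.
Qed.

Lemma cis_neq_0 (a : R) : cis a <> 0%C.
Proof. intros H. assert (E := Cmod_cis a). rewrite H, Cmod_0 in E. lra. Qed.

(** The integrand of [Hi_moment] after the substitution of [s * cis phi] for the
    variable, including the Jacobian [cis phi]: its integral over [s] is the integral
    along the ray of argument [phi]. *)
Definition ray_integrand (j : nat) (z : C) (phi s : R) : C :=
  (cis phi * ((s * cis phi) ^ j * Cexp (- (1 / 3) * (s * cis phi) ^ 3 + z * (s * cis phi))))%C.

Definition ray_log_mod (rho theta phi s : R) : R :=
  - (s ^ 3 * cos (3 * phi) / 3) - rho * (s * cos (theta + phi)).

Definition ray_arg (rho theta phi s : R) : R :=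
  - (s ^ 3 * sin (3 * phi) / 3) - rho * (s * sin (theta + phi)).

Lemma ray_integrand_polar (j : nat) (rho theta phi s : R) :
  ray_integrand j (- (rho * cis theta)) phi s =
  (s ^ j * exp (ray_log_mod rho theta phi s)
   * cis (INR (S j) * phi + ray_arg rho theta phi s))%C.
Proof.
unfold ray_integrand.
replace (- (1 / 3) * (s * cis phi) ^ 3 + - (rho * cis theta) * (s * cis phi))%C
  with (ray_log_mod rho theta phi s, ray_arg rho theta phi s).
2:{ rewrite Cpow_mult_l, cis_pow.
    replace (- (rho * cis theta) * (s * cis phi))%C
      with (- (rho * s * (cis theta * cis phi)))%C by ring.
    rewrite <- cis_plus, <- RtoC_pow. replace (INR 3) with 3 by (simpl; ring).
    unfold ray_log_mod, ray_arg, cis. apply injective_projections; simpl; field. }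
replace (Cexp (ray_log_mod rho theta phi s, ray_arg rho theta phi s))
  with (exp (ray_log_mod rho theta phi s) * cis (ray_arg rho theta phi s))%C
  by (unfold Cexp, cis; apply injective_projections; simpl; ring).
rewrite cis_plus, S_INR, Rmult_plus_distr_r, Rmult_1_l, cis_plus, <- cis_pow, Cpow_mult_l. ring.
Qed.

Lemma ray_integrand_0 (j : nat) (z : C) (s : R) :
  ray_integrand j z 0 s = Hi_integrand j z s.
Proof. unfold ray_integrand, Hi_integrand. rewrite cis_0, !Cmult_1_r. ring. Qed.

Lemma continuous_ray_integrand (j : nat) (z : C) (phi s : R) :
  Ccontinuous (ray_integrand j z phi) s.
Proof. unfold ray_integrand. C_cont. Qed.

Ltac cont_2d :=
  match goal with
  | |- continuity_2d_pt (fun _ _ => ?c) _ _ => apply continuity_2d_pt_const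
  | |- continuity_2d_pt (fun u _ => u) _ _ => apply continuity_2d_pt_id1
  | |- continuity_2d_pt (fun _ v => v) _ _ => apply continuity_2d_pt_id2
  | |- continuity_2d_pt (fun u v => @?f u v + @?g u v) _ _ =>
      apply (continuity_2d_pt_plus f g); cont_2d
  | |- continuity_2d_pt (fun u v => @?f u v - @?g u v) _ _ =>
      apply (continuity_2d_pt_minus f g); cont_2d
  | |- continuity_2d_pt (fun u v => - @?f u v) _ _ =>
      apply (continuity_2d_pt_opp f); cont_2d
  | |- continuity_2d_pt (fun u v => @?f u v * @?g u v) _ _ =>
      apply (continuity_2d_pt_mult f g); cont_2d
  | |- continuity_2d_pt (fun u v => @?f u v / ?c) _ _ =>
      apply (continuity_2d_pt_mult f (fun _ _ => / c)); cont_2d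
  | |- continuity_2d_pt (fun u v => exp (@?f u v)) _ _ =>
      apply (continuity_1d_2d_pt_comp exp f);
      [apply derivable_continuous_pt, derivable_pt_exp | cont_2d]
  | |- continuity_2d_pt (fun u v => cos (@?f u v)) _ _ =>
      apply (continuity_1d_2d_pt_comp cos f);
      [apply derivable_continuous_pt, derivable_pt_cos | cont_2d]
  | |- continuity_2d_pt (fun u v => sin (@?f u v)) _ _ =>
      apply (continuity_1d_2d_pt_comp sin f);
      [apply derivable_continuous_pt, derivable_pt_sin | cont_2d]
  | |- continuity_2d_pt (fun u v => (@?f u v) ^ ?n) _ _ =>
      apply (continuity_1d_2d_pt_comp (fun x => x ^ n) f);
      [apply derivable_continuous_pt, derivable_pt_pow | cont_2d]
  end.

(** The shift [c] selects the real part ([c = 0]) or the imaginary part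
    ([c = - (PI / 2)]) of the integrand, so each analytic fact is proved once. *)
Definition ray_wave (j : nat) (rho theta c phi s : R) : R :=
  s ^ j * exp (ray_log_mod rho theta phi s)
  * cos (INR (S j) * phi + ray_arg rho theta phi s + c).

(** The boundary term of Cauchy's theorem on a circular sector: the angular derivative
    of [ray_wave] is exactly minus the radial derivative of [ray_flux]. *)
Definition ray_flux (j : nat) (rho theta c phi s : R) : R :=
  s ^ S j * exp (ray_log_mod rho theta phi s)
  * sin (INR (S j) * phi + ray_arg rho theta phi s + c).

Definition ray_wave_dphi (j : nat) (rho theta c phi s : R) : R :=
  s ^ j * exp (ray_log_mod rho theta phi s)
  * ((s ^ 3 * sin (3 * phi) + rho * (s * sin (theta + phi)))
       * cos (INR (S j) * phi + ray_arg rho theta phi s + c)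
     + (s ^ 3 * cos (3 * phi) + rho * (s * cos (theta + phi)) - INR (S j))
       * sin (INR (S j) * phi + ray_arg rho theta phi s + c)).

Lemma is_derive_ray_wave (j : nat) (rho theta c phi s : R) :
  is_derive (fun u => ray_wave j rho theta c u s) phi (ray_wave_dphi j rho theta c phi s).
Proof.
unfold ray_wave, ray_wave_dphi, ray_log_mod, ray_arg.
generalize (INR (S j)) (s ^ j) (s ^ 3). intros N p q.
auto_derive; auto. unfold Rminus, Rdiv. field.
Qed.

Lemma is_derive_ray_flux (j : nat) (rho theta c phi s : R) :
  is_derive (fun v => - ray_flux j rho theta c phi v) s (ray_wave_dphi j rho theta c phi s).
Proof.
unfold ray_flux, ray_wave_dphi, ray_log_mod, ray_arg. auto_derive; auto.
change (match j with 0%nat => 1 | S _ => INR j + 1 end) with (INR (S j)).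
cbn -[INR]. unfold Rminus, Rdiv. field.
Qed.

(** Cauchy's theorem in infinitesimal form. Turning the ray changes the integrand by a
    derivative in [s], so the truncated integral changes only through its end point at
    distance [X]; the end point at the origin contributes nothing because of the
    factor [s ^ S j]. *)
Lemma is_derive_RInt_ray_wave (j : nat) (rho theta c phi X : R) :
  is_derive (fun u => RInt (ray_wave j rho theta c u) 0 X) phi (- ray_flux j rho theta c phi X).
Proof.
assert (HD : forall u s, Derive (fun u => ray_wave j rho theta c u s) u = ray_wave_dphi j rho theta c u s)
  by (intros; apply is_derive_unique, is_derive_ray_wave).
replace (- ray_flux j rho theta c phi X)
  with (RInt (fun s => Derive (fun u => ray_wave j rho theta c u s) phi) 0 X).
- apply (is_derive_RInt_param (ray_wave j rho theta c)).
  + apply filter_forall. intros u s _. eexists. apply is_derive_ray_wave.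
  + intros s _. apply (continuity_2d_pt_ext (ray_wave_dphi j rho theta c)); [intros; now rewrite HD|].
    unfold ray_wave_dphi, ray_log_mod, ray_arg. cont_2d.
  + apply filter_forall. intros u. apply (ex_RInt_continuous (V := R_CompleteNormedModule)). intros s _.
    apply (ex_derive_continuous (V := R_NormedModule)). unfold ray_wave, ray_log_mod, ray_arg. auto_derive; auto.
- apply (is_RInt_unique (V := R_CompleteNormedModule)).
  apply (is_RInt_ext (V := R_NormedModule) (ray_wave_dphi j rho theta c phi)); [intros; now rewrite HD|].
  replace (- ray_flux j rho theta c phi X)
    with (minus (- ray_flux j rho theta c phi X) (- ray_flux j rho theta c phi 0)).
  + apply (is_RInt_derive (V := R_CompleteNormedModule) (fun s => - ray_flux j rho theta c phi s)).
    * intros s _. apply is_derive_ray_flux.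
    * intros s _. apply (ex_derive_continuous (V := R_NormedModule)).
      unfold ray_wave_dphi, ray_log_mod, ray_arg. auto_derive; auto.
  + change (- ray_flux j rho theta c phi X - (- ray_flux j rho theta c phi 0) = - ray_flux j rho theta c phi X).
    unfold ray_flux at 2. rewrite (pow_ne_zero (S j)) by lia. ring.
Qed.

(** Exponential decay on the arc joining the rays of arguments [0] and [phi]. Neither term
    suffices alone: [cos (3 * phi)] vanishes when [Rabs phi = PI / 6], and
    [cos (theta + u)] may be negative away from [u = phi]. With [psi = Rabs (phi - u)], one
    has [cos (theta + u) >= cos (theta + phi) / 2 - sin psi] and [cos (3 * u) >= sin psi],
    and for [3 * rho <= X ^ 2] the cubic gain outweighs the loss in the linear term. *)
Lemma ray_log_mod_le (rho theta phi u X : R) :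
  0 <= rho -> Rabs phi <= PI / 6 -> 0 <= cos (theta + phi) ->
  Rmin 0 phi <= u <= Rmax 0 phi -> 0 <= X -> 3 * rho <= X ^ 2 ->
  ray_log_mod rho theta u X <= - (rho * cos (theta + phi) / 2 * X).
Proof.
intros Hrho Hphi Hc Hu HX HX2.
assert (HP := PI_RGT_0).
set (psi := Rabs (phi - u)).
assert (Hpsi : 0 <= psi /\ Rabs u + psi = Rabs phi).
{ split; [apply Rabs_pos|]. unfold psi, Rmin, Rmax in *.
  destruct (Rle_dec 0 phi).
  - rewrite !Rabs_pos_eq by lra. ring.
  - rewrite !Rabs_left1 by lra. ring. }
assert (Hup := Rabs_pos u).
assert (H3 : sin psi <= cos (3 * u)).
{ replace (cos (3 * u)) with (sin (PI / 2 - 3 * Rabs u)).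
  2:{ rewrite sin_shift. unfold Rabs. destruct (Rcase_abs u); [|reflexivity].
      rewrite <- cos_neg. f_equal. ring. }
  apply sin_incr_1; lra. }
assert (H1 : 1 / 2 <= cos psi).
{ rewrite <- cos_PI3. apply cos_decr_1; lra. }
assert (Hs0 : 0 <= sin psi) by (apply sin_ge_0; lra).
assert (Hth : cos (theta + phi) / 2 - sin psi <= cos (theta + u)).
{ replace (theta + u) with ((theta + phi) - (phi - u)) by ring.
  rewrite cos_minus.
  assert (E : cos (phi - u) = cos psi /\ Rabs (sin (phi - u)) = sin psi).
  { unfold psi, Rabs at 1 3. unfold psi in Hs0. unfold Rabs in Hs0.
    destruct (Rcase_abs (phi - u)).
    - rewrite cos_neg, sin_neg. rewrite sin_neg in Hs0. split; [reflexivity|].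
      apply Rabs_left1. lra.
    - split; [reflexivity|]. now apply Rabs_pos_eq. }
  destruct E as [-> E].
  assert (Hb := SIN_bound (theta + phi)).
  assert (Hab : - sin psi <= sin (theta + phi) * sin (phi - u)).
  { assert (HR : Rabs (sin (theta + phi) * sin (phi - u)) <= sin psi).
    { rewrite Rabs_mult, E. rewrite <- (Rmult_1_l (sin psi)) at 2.
      apply Rmult_le_compat_r; [exact Hs0|]. now apply Rabs_le. }
    apply Rabs_le_between in HR. lra. }
  nra. }
unfold ray_log_mod.
assert (Q1 := Rmult_le_compat_l (X ^ 3) _ _ (pow_le X 3 HX) H3).
assert (HrX : 0 <= rho * X) by now apply Rmult_le_pos.
assert (Q2 := Rmult_le_compat_l _ _ _ HrX Hth).
assert (Q3 : 0 <= (sin psi * X) * (X ^ 2 - 3 * rho)).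
{ apply Rmult_le_pos; [now apply Rmult_le_pos|lra]. }
simpl in *. nra.
Qed.

Lemma Cmod_le_Rabs_plus (u : C) : Cmod u <= Rabs (Re u) + Rabs (Im u).
Proof.
replace u with (RtoC (Re u) + Ci * RtoC (Im u))%C at 1
  by (destruct u; apply injective_projections; simpl; ring).
eapply Rle_trans; [apply Cmod_triangle|].
rewrite Cmod_mult, !Cmod_R. 
replace (Cmod Ci) with 1; [lra|].
unfold Cmod, Ci; simpl. replace (_ + _) with 1 by ring. symmetry; apply sqrt_1.
Qed.

Lemma RInt_ray_wave_rotate (j : nat) (rho theta c phi X : R) :
  0 <= rho -> Rabs phi <= PI / 6 -> 0 <= cos (theta + phi) -> 0 <= X -> 3 * rho <= X ^ 2 ->
  Rabs (RInt (ray_wave j rho theta c phi) 0 X - RInt (ray_wave j rho theta c 0) 0 X)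
    <= X ^ S j * exp (- (rho * cos (theta + phi) / 2 * X)) * Rabs phi.
Proof.
intros Hrho Hphi Hc HX HX2.
destruct (MVT_abs (fun u => RInt (ray_wave j rho theta c u) 0 X) (fun u => - ray_flux j rho theta c u X) 0 phi)
  as [u [E Hu]].
{ intros u _. apply is_derive_Reals, is_derive_RInt_ray_wave. }
rewrite E, Rminus_0_r. apply Rmult_le_compat_r; [apply Rabs_pos|].
assert (Hl := ray_log_mod_le rho theta phi u X Hrho Hphi Hc Hu HX HX2).
rewrite Rabs_Ropp. unfold ray_flux.
assert (Hp : 0 <= X ^ S j) by now apply pow_le.
rewrite !Rabs_mult, (Rabs_pos_eq (X ^ S j)), (Rabs_pos_eq (exp _)) by (assumption || (left; apply exp_pos)).
assert (Hs : Rabs (sin (INR (S j) * u + ray_arg rho theta u X + c)) <= 1) by apply Rabs_le, SIN_bound.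
assert (He : exp (ray_log_mod rho theta u X) <= exp (- (rho * cos (theta + phi) / 2 * X)))
  by (destruct Hl as [Hl|Hl]; [left; now apply exp_increasing|rewrite Hl; lra]).
rewrite <- (Rmult_1_r (X ^ S j * exp (- _))).
apply Rmult_le_compat; [apply Rmult_le_pos; [exact Hp|left; apply exp_pos] | apply Rabs_pos | | exact Hs].
now apply Rmult_le_compat_l.
Qed.

Lemma ray_integral_components (j : nat) (rho theta phi X : R) :
  CInt (ray_integrand j (- (rho * cis theta)) phi) 0 X =
  (RInt (ray_wave j rho theta 0 phi) 0 X, RInt (ray_wave j rho theta (- (PI / 2)) phi) 0 X).
Proof.
apply CInt_unique.
assert (Hex : forall c, ex_RInt (V := R_NormedModule) (ray_wave j rho theta c phi) 0 X).
{ intros c. apply (ex_RInt_continuous (V := R_CompleteNormedModule)). intros s _.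
  apply (ex_derive_continuous (V := R_NormedModule)). unfold ray_wave, ray_log_mod, ray_arg. auto_derive; auto. }
apply (is_RInt_fct_extend_pair (U := R_NormedModule) (V := R_NormedModule)).
- apply (is_RInt_ext (V := R_NormedModule) (ray_wave j rho theta 0 phi)).
  + intros s _. rewrite ray_integrand_polar, <- RtoC_pow. unfold ray_wave. rewrite Rplus_0_r.
    generalize (INR (S j) * phi + ray_arg rho theta phi s). intros w. simpl. ring.
  + apply (RInt_correct (V := R_CompleteNormedModule)), Hex.
- apply (is_RInt_ext (V := R_NormedModule) (ray_wave j rho theta (- (PI / 2)) phi)).
  + intros s _. rewrite ray_integrand_polar, <- RtoC_pow. unfold ray_wave.
    generalize (INR (S j) * phi + ray_arg rho theta phi s). intros w.
    replace (cos (w + - (PI / 2))) with (sin w) by (rewrite <- cos_shift, <- cos_neg; f_equal; ring).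
    simpl. ring.
  + apply (RInt_correct (V := R_CompleteNormedModule)), Hex.
Qed.

(** Rotation of the path of integration. The rotated improper integral is described only
    through its truncations, whose limit is inherited from the unrotated one. *)
Lemma Hi_moment_rotate (j : nat) (rho theta phi : R) :
  0 < rho -> Rabs phi <= PI / 6 -> 0 < cos (theta + phi) ->
  at_infinity (fun X => CInt (ray_integrand j (- (rho * cis theta)) phi) 0 X)
    (Hi_moment j (- (rho * cis theta))).
Proof.
intros Hrho Hphi Hc.
set (z := (- (rho * cis theta))%C).
set (F := (fun a X => CInt (ray_integrand j z a) 0 X) : R -> R -> C).
assert (H0 : at_infinity (F 0) (Hi_moment j z)).
{ apply (filterlim_ext (fun X => CInt (Hi_integrand j z) 0 X)); [|apply Hi_moment_spec].
  intros X. apply (RInt_ext (V := C_R_CompleteNormedModule)). intros s _. symmetry; apply ray_integrand_0. }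
apply (filterlim_ext (fun X => (F phi X - F 0 X) + F 0 X)%C).
{ intros X. change (F phi X - F 0 X + F 0 X = F phi X)%C. ring. }
rewrite <- (Cplus_0_l (Hi_moment j z)). apply at_infinity_plus; [|exact H0].
set (a := rho * cos (theta + phi) / 2).
assert (Ha : 0 < a) by (unfold a; assert (0 < rho * cos (theta + phi)) by (apply Rmult_lt_0_compat; assumption); lra).
apply (at_infinity_squeeze _ (fun X => 2 * Rabs phi * (X ^ S j * exp (- (a * X))))).
(* [X > 3 * rho + 1] ensures [3 * rho <= X ^ 2]. *)
- exists (3 * rho + 1). intros X HX. unfold Cminus at 1. rewrite Copp_0, Cplus_0_r.
  unfold F, z. rewrite !ray_integral_components.
  eapply Rle_trans; [apply Cmod_le_Rabs_plus|].
  assert (HX2 : 3 * rho <= X ^ 2) by nra.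
  assert (HR := fun c => RInt_ray_wave_rotate j rho theta c phi X ltac:(lra) Hphi ltac:(lra) ltac:(lra) HX2).
  fold a in HR.
  assert (A1 := HR 0). assert (A2 := HR (- (PI / 2))). 
  unfold Cminus. simpl Re; simpl Im. unfold Rminus in *. simpl fst; simpl snd.
  set (t := X ^ S j * exp (- (a * X)) * Rabs phi) in *.
  replace (2 * Rabs phi * (X ^ S j * exp (- (a * X)))) with (t + t) by (unfold t; ring).
  now apply Rplus_le_compat.
- replace (Finite 0) with (Rbar_mult (2 * Rabs phi) 0) by (simpl; f_equal; ring).
  apply is_lim_scal_l. now apply is_lim_pow_exp.
Qed.

(** * The error bounds *)

(** The asymptotic expansion of [Hi_moment j]: expanding [exp (- t ^ 3 / 3)] and integrating
    termwise gives [k]-th term [(-1/3)^k / k! * (3k+j)! / (-z)^(3k+j+1)], from which the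
    common factor [/ (- z) ^ (j + 1)] is taken out. *)
Definition Hi_moment_sum (j n : nat) (z : C) : C :=
  (/ (- z) ^ S j *
   sum_n (fun k => INR (fact (3 * k + j)) / (INR (fact k) * (3 * z ^ 3) ^ k)) n)%C.

Lemma is_CInt_sum (c : nat -> C) (f : nat -> R -> C) (l : nat -> C) (n : nat) (a b : R) :
  (forall k, is_RInt (V := C_R_NormedModule) (f k) a b (l k)) ->
  is_RInt (V := C_R_NormedModule)
    (fun t => sum_n (G := C_AbelianMonoid) (fun k => c k * f k t)%C n) a b
    (sum_n (G := C_AbelianMonoid) (fun k => c k * l k)%C n).
Proof.
intros H. induction n as [|n IH].
- rewrite sum_O. apply (is_RInt_ext (V := C_R_NormedModule) (fun t => c O * f O t)%C).
  + intros t _. now rewrite sum_O.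
  + now apply is_CInt_Cmult.
- rewrite sum_Sn.
  apply (is_RInt_ext (V := C_R_NormedModule)
    (fun t => plus (G := C_R_NormedModule) (sum_n (G := C_AbelianMonoid) (fun k => c k * f k t)%C n) (c (S n) * f (S n) t)%C)).
  + intros t _. now rewrite sum_Sn.
  + apply (is_RInt_plus (V := C_R_NormedModule)); [exact IH | now apply is_CInt_Cmult].
Qed.

(** Along the ray, the power of [cis phi] collects [3 * k] factors from the cubic, [j] from
    the moment and one from the Jacobian. *)
Definition ray_coeff (j : nat) (phi : R) (k : nat) : C :=
  (/ INR (fact k) * (- (1 / 3)) ^ k * cis phi ^ S (3 * k + j))%C.

Lemma INR_fact_C_neq_0 (n : nat) : RtoC (INR (fact n)) <> 0%C.
Proof. intros E. apply RtoC_inj in E. exact (INR_fact_neq_0 _ E). Qed.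

(** The powers of [cis phi] cancel: the expansion does not depend on the ray along which it
    is computed. *)
Lemma ray_coeff_lim (j k : nat) (phi : R) (z : C) : z <> 0%C ->
  (ray_coeff j phi k * (INR (fact (3 * k + j)) / (- z * cis phi) ^ S (3 * k + j))
   = / (- z) ^ S j * (INR (fact (3 * k + j)) / (INR (fact k) * (3 * z ^ 3) ^ k)))%C.
Proof.
intros Hz. unfold ray_coeff.
assert (Hz' : (- z)%C <> 0%C).
{ intros E. apply Hz. replace z with (- - z)%C by ring. rewrite E. ring. }
assert (Hcis := Cpow_nz _ (S (3 * k + j)) (cis_neq_0 phi)).
assert (Hf := INR_fact_C_neq_0 k).
assert (H3 : (3 ^ k)%C <> 0%C).
{ apply Cpow_nz. intros E. apply RtoC_inj in E. lra. }
assert (Hzk : ((z ^ 3) ^ k)%C <> 0%C) by now apply Cpow_nz, Cpow_nz.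
assert (Hzj : ((- z) ^ S j)%C <> 0%C) by now apply Cpow_nz.
assert (H1 : ((-1) ^ k)%C <> 0%C).
{ apply Cpow_nz. intros E. apply RtoC_inj in E. lra. }
rewrite !Cpow_mult_l.
replace ((- (1 / 3)) ^ k)%C with ((-1) ^ k / 3 ^ k)%C.
2:{ unfold Cdiv. rewrite <- Cpow_inv, <- Cpow_mult_l.
    - f_equal. field.
    - intros E. apply RtoC_inj in E. lra. }
replace ((- z) ^ S (3 * k + j))%C with ((-1) ^ k * (z ^ 3) ^ k * (- z) ^ S j)%C.
2:{ replace (S (3 * k + j)) with (3 * k + S j)%nat by lia.
    rewrite Cpow_add_r, Cpow_mult_r, <- Cpow_mult_l. f_equal. f_equal. ring. }
field. repeat split; assumption.
Qed.

(** This is where the restriction [Rabs phi <= PI / 6] is needed: it makes the real part of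
    the cube of [s * cis phi] nonnegative, so that the Taylor remainder of the cubic
    exponential is at most the modulus of the first omitted term. *)
Lemma ray_remainder_bound (j n : nat) (rho theta phi s : R) :
  Rabs phi <= PI / 6 -> 0 <= s ->
  let b := (rho * cis (theta + phi))%C in
  Cmod (ray_integrand j (- (rho * cis theta)) phi s
        - sum_n (G := C_AbelianMonoid)
            (fun k => ray_coeff j phi k * (s ^ (3 * k + j) * Cexp (- (b * s))))%C n)
  <= / (3 ^ S n * INR (fact (S n)))
     * (s ^ (3 * S n + j) * exp (- (rho * cos (theta + phi) * s))).
Proof.
intros Hphi Hs b.
set (u := (- (1 / 3) * (s * cis phi) ^ 3)%C).
set (E := Cexp (- (b * s))).
assert (HE : Cmod E = exp (- (rho * cos (theta + phi) * s))).
{ unfold E. rewrite Cmod_Cexp. f_equal. unfold b, cis. simpl. ring. }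
replace (ray_integrand j (- (rho * cis theta)) phi s)
  with (cis phi * (s * cis phi) ^ j * E * Cexp u)%C.
2:{ unfold ray_integrand, E. rewrite Cexp_plus. fold u.
    replace (- (rho * cis theta) * (s * cis phi))%C with (- (b * s))%C; [ring|].
    unfold b. rewrite cis_plus. ring. }
replace (sum_n _ n) with (cis phi * (s * cis phi) ^ j * E * exp_poly n u)%C.
2:{ unfold exp_poly.
    rewrite <- (sum_n_mult_l (K := C_Ring)). apply (sum_n_ext (G := C_AbelianMonoid)). intros k.
    change (cis phi * (s * cis phi) ^ j * E * (/ INR (fact k) * u ^ k)
            = ray_coeff j phi k * (s ^ (3 * k + j) * E))%C.
    unfold u, ray_coeff.
    rewrite !Cpow_mult_l, (Cpow_S _ (3 * k + j)), !Cpow_add_r, !Cpow_mult_r. ring. }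
replace (cis phi * (s * cis phi) ^ j * E * Cexp u - cis phi * (s * cis phi) ^ j * E * exp_poly n u)%C
  with (cis phi * (s * cis phi) ^ j * E * (Cexp u - exp_poly n u))%C by ring.
assert (Hu : Cmod u = s ^ 3 / 3).
{ unfold u. rewrite Cmod_mult, Cmod_pow, Cmod_mult, Cmod_cis, Cmod_R, Rabs_pos_eq, Rmult_1_r by exact Hs.
  rewrite Cmod_opp, Cmod_div, !Cmod_R, !Rabs_pos_eq by (try lra; intros C0; apply RtoC_inj in C0; lra). field. }
assert (Hre : Re u <= 0).
{ replace (Re u) with (- (s ^ 3 * cos (3 * phi) / 3)).
  2:{ unfold u. rewrite Cpow_mult_l, cis_pow, <- RtoC_pow.
      replace (INR 3) with 3 by (simpl; ring). unfold cis. simpl. field. }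
  assert (0 <= s ^ 3 * cos (3 * phi)); [|lra].
  apply Rmult_le_pos; [now apply pow_le|].
  apply Rabs_le_between in Hphi. apply cos_ge_0; lra. }
assert (HT := Cexp_taylor n u).
rewrite Rmax_left, Rmult_1_l, Hu in HT.
2:{ rewrite <- exp_0. destruct Hre as [Hre|Hre]; [left; now apply exp_increasing|rewrite Hre; lra]. }
rewrite !Cmod_mult, Cmod_pow, Cmod_mult, Cmod_cis, Cmod_R, Rabs_pos_eq, HE by exact Hs.
rewrite Rmult_1_l, Rmult_1_r.
eapply Rle_trans; [apply Rmult_le_compat_l; [|exact HT]|].
- apply Rmult_le_pos; [now apply pow_le|left; apply exp_pos].
- right. rewrite pow_add, pow_mult. unfold Rdiv. rewrite Rpow_mult_distr, pow_inv.
  field. split; [apply INR_fact_neq_0|apply pow_nonzero; lra].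
Qed.

(** The remainder is integrated along the ray of argument [phi], where the integrand of the
    error is dominated by the modulus of the first omitted term; the integral of that
    modulus is a real Gamma integral with rate [rho * cos (theta + phi)]. *)
Lemma Hi_moment_error (j n : nat) (rho theta phi : R) :
  0 < rho -> Rabs phi <= PI / 6 -> 0 < cos (theta + phi) ->
  let z := (- (rho * cis theta))%C in
  Cmod (Hi_moment j z - Hi_moment_sum j n z)
  <= INR (fact (3 * S n + j))
     / (3 ^ S n * INR (fact (S n)) * (rho * cos (theta + phi)) ^ S (3 * S n + j)).
Proof.
intros Hrho Hphi Hc z.
assert (Hz : z <> 0%C).
{ intros E. assert (H : Cmod z = rho).
  { unfold z. rewrite Cmod_opp, Cmod_mult, Cmod_cis, Cmod_R, Rabs_pos_eq; lra. }
  rewrite E, Cmod_0 in H. lra. }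
set (b := (rho * cis (theta + phi))%C).
assert (Hb : b = (- z * cis phi)%C) by (unfold b, z; rewrite cis_plus; ring).
set (a := rho * cos (theta + phi)).
assert (Ha : 0 < a) by now apply Rmult_lt_0_compat.
assert (Hre : Re b = a) by (unfold b, a, cis; simpl; ring).
set (F := fun X : R => (CInt (ray_integrand j z phi) 0 X
  - sum_n (G := C_AbelianMonoid) (fun k => ray_coeff j phi k * exp_moment (3 * k + j) b X)%C n)%C).
apply (at_infinity_Cmod_le F).
{ apply at_infinity_minus; [now apply Hi_moment_rotate|].
  replace (Hi_moment_sum j n z) with
    (sum_n (G := C_AbelianMonoid) (fun k => ray_coeff j phi k * (INR (fact (3 * k + j)) / b ^ S (3 * k + j)))%C n).
  - apply (at_infinity_sum (fun k X => ray_coeff j phi k * exp_moment (3 * k + j) b X)%C). intros k.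
    apply at_infinity_scal, exp_moment_lim. lra.
  - unfold Hi_moment_sum. rewrite <- (sum_n_mult_l (K := C_Ring)).
    apply (sum_n_ext (G := C_AbelianMonoid)). intros k. rewrite Hb. now apply ray_coeff_lim. }
exists 0. intros X HX.
set (q := / (3 ^ S n * INR (fact (S n)))).
assert (H3 : 0 < 3 ^ S n) by (apply pow_lt; lra).
assert (Hf := INR_fact_lt_0 (S n)).
assert (Hq : 0 < q) by (unfold q; apply Rinv_0_lt_compat, Rmult_lt_0_compat; assumption).
apply Rle_trans with (q * RInt (fun s => s ^ (3 * S n + j) * exp (- (a * s))) 0 X).
- refine (is_CInt_norm_le _ (fun s => q * (s ^ (3 * S n + j) * exp (- (a * s)))) 0 X (F X) _ _ _
    (is_RInt_minus (V := C_R_NormedModule) _ _ 0 X _ _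
       (CInt_correct _ 0 X (continuous_ray_integrand j z phi))
       (is_CInt_sum (ray_coeff j phi) (fun k (s : R) => s ^ (3 * k + j) * Cexp (- (b * s)))%C _ n 0 X
          (fun k => CInt_correct _ 0 X _))) _).
  + lra.
  + intros s [Hs _]. now apply ray_remainder_bound.
  + intros s. C_cont.
  + apply (is_RInt_scal (V := R_NormedModule)), (RInt_correct (V := R_CompleteNormedModule)).
    apply (ex_RInt_continuous (V := R_CompleteNormedModule)). intros s _.
    apply (ex_derive_continuous (V := R_NormedModule) (fun s => s ^ (3 * S n + j) * exp (- (a * s)))).
    auto_derive; auto.
- eapply Rle_trans; [apply Rmult_le_compat_l; [lra|apply RInt_pow_exp_le; lra]|].
  right. unfold q. field. repeat split; try apply INR_fact_neq_0; apply pow_nonzero; lra.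
Qed.

Lemma Hi_err_moment (n : nat) (z : C) : z <> 0%C -> Hi_err n z = (Hi_moment 0 z - Hi_moment_sum 0 n z)%C.
Proof.
intros Hz. unfold Hi_err, Hi_moment_sum. rewrite Hi_moment_0.
replace (Hi_sum n z) with
  (sum_n (G := C_AbelianMonoid) (fun k => INR (fact (3 * k + 0)) / (INR (fact k) * (3 * z ^ 3) ^ k))%C n).
2:{ apply (sum_n_ext (G := C_AbelianMonoid)). intros k. now rewrite Nat.add_0_r. }
assert (HP : RtoC PI <> 0%C) by (intros E; apply RtoC_inj in E; exact (PI_neq0 E)).
rewrite Cpow_1_r. to_C. field. now split.
Qed.

Lemma Hi'_err_moment (n : nat) (z : C) : z <> 0%C -> Hi'_err n z = (Hi_moment 1 z - Hi_moment_sum 1 n z)%C.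
Proof.
intros Hz. unfold Hi'_err, Hi_moment_sum. rewrite Hi'_moment_1.
unfold Hi'_sum.
assert (HP : RtoC PI <> 0%C) by (intros E; apply RtoC_inj in E; exact (PI_neq0 E)).
to_C. field. now split.
Qed.

(** The best admissible ray: for [Rabs theta <= PI / 6] the choice [phi = - theta] makes the
    cosine equal to [1]; beyond that, [phi] is the end point of [[- PI / 6, PI / 6]] closest
    to [- theta]. *)
Lemma Hi_moment_error_sectors (j n : nat) (z : C) (theta : R) :
  z <> 0%C -> theta = Carg (- z) ->
  (Rabs theta <= 1 / 6 * PI ->
   Cmod (Hi_moment j z - Hi_moment_sum j n z) <=
     INR (fact (3 * S n + j)) / (3 ^ S n * INR (fact (S n)) * Cmod z ^ S (3 * S n + j))) /\
  (1 / 6 * PI < Rabs theta < 2 / 3 * PI ->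
   Cmod (Hi_moment j z - Hi_moment_sum j n z) <=
     INR (fact (3 * S n + j)) / (3 ^ S n * INR (fact (S n))
       * (Cmod z * cos (Rabs theta - 1 / 6 * PI)) ^ S (3 * S n + j))).
Proof.
intros Hz Ht.
assert (Hz' : (- z)%C <> 0%C).
{ intros E. apply Hz. replace z with (- - z)%C by ring. rewrite E. ring. }
assert (HP := PI_RGT_0).
assert (Hm := proj1 (Cmod_gt_0 z) Hz).
assert (E : z = (- (Cmod z * cis theta))%C).
{ destruct (Carg_spec _ Hz') as [_ H]. rewrite <- Ht, Cmod_opp in H.
  replace z with (- - z)%C at 1 by ring. rewrite H. unfold cis.
  apply injective_projections; simpl; ring. }
assert (HB := fun phi => Hi_moment_error j n (Cmod z) theta phi Hm).
cbv zeta in HB. rewrite <- E in HB.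
split; intros Hth.
- assert (H := HB (- theta)). rewrite Rplus_opp_r, cos_0, Rmult_1_r, Rabs_Ropp in H. apply H; lra.
- destruct (Rle_dec 0 theta) as [Hs|Hs].
  + rewrite (Rabs_pos_eq theta) in * by exact Hs.
    replace (theta - 1 / 6 * PI) with (theta + - (PI / 6)) by field.
    apply HB; [rewrite Rabs_Ropp, Rabs_pos_eq; lra|apply cos_gt_0; lra].
  + rewrite (Rabs_left theta) in * by lra.
    replace (cos (- theta - 1 / 6 * PI)) with (cos (theta + PI / 6)) by (rewrite <- cos_neg; f_equal; field).
    apply HB; [rewrite Rabs_pos_eq; lra|apply cos_gt_0; lra].
Qed.

Theorem theorem4p1 :
  forall (z : C) (delta : R), z <> 0%C -> 0 < delta ->
  let theta := Carg (- z) in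
  forall n : nat,
  (Hi z = - (1 / (PI * z)) * Hi_sum n z + 1 / PI * Hi_err n z)%C /\
  (Rabs theta <= 1 / 6 * PI ->
   Cmod (Hi_err n z) <=
     INR (fact (3 * n + 3)) /
     (3 ^ (n + 1) * INR (fact (n + 1)) * Cmod z ^ (3 * n + 4))) /\
  (1 / 6 * PI < Rabs theta <= 2 / 3 * PI - delta ->
   Cmod (Hi_err n z) <=
     INR (fact (3 * n + 3)) /
     (3 ^ (n + 1) * INR (fact (n + 1)) *
      (Cmod z * cos (Rabs theta - 1 / 6 * PI)) ^ (3 * n + 4))) /\
  is_derive (K := C_AbsRing) (V := C_NormedModule) Hi z (Hi' z) /\
  (Hi' z = 1 / (PI * z ^ 2) * Hi'_sum n z + 1 / PI * Hi'_err n z)%C /\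
  (Rabs theta <= 1 / 6 * PI ->
   Cmod (Hi'_err n z) <=
     INR (fact (3 * n + 4)) /
     (3 ^ (n + 1) * INR (fact (n + 1)) * Cmod z ^ (3 * n + 5))) /\
  (1 / 6 * PI < Rabs theta <= 2 / 3 * PI - delta ->
   Cmod (Hi'_err n z) <=
     INR (fact (3 * n + 4)) /
     (3 ^ (n + 1) * INR (fact (n + 1)) *
      (Cmod z * cos (Rabs theta - 1 / 6 * PI)) ^ (3 * n + 5))).
Proof.
intros z delta Hz Hdelta theta n.
assert (HP : RtoC PI <> 0%C) by (intros E; apply RtoC_inj in E; exact (PI_neq0 E)).
destruct (Hi_moment_error_sectors 0 n z theta Hz eq_refl) as [A0 B0].
destruct (Hi_moment_error_sectors 1 n z theta Hz eq_refl) as [A1 B1].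
rewrite <- Hi_err_moment in A0, B0 by exact Hz.
rewrite <- Hi'_err_moment in A1, B1 by exact Hz.
replace (S (3 * S n + 0)) with (3 * n + 4)%nat in A0, B0 by lia.
replace (3 * S n + 0)%nat with (3 * n + 3)%nat in A0, B0 by lia.
replace (S (3 * S n + 1)) with (3 * n + 5)%nat in A1, B1 by lia.
replace (3 * S n + 1)%nat with (3 * n + 4)%nat in A1, B1 by lia.
replace (S n) with (n + 1)%nat in * by lia.
split; [|split; [exact A0|split; [intros; apply B0; lra|split; [|split; [|split; [exact A1|intros; apply B1; lra]]]]]].
- unfold Hi_err. field. now split.
- rewrite Hi'_moment_1. apply is_derive_Hi.
- unfold Hi'_err. field. now split.
Qed.
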